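(* Let $A$ be a group which is finitely presented relative to a collection of subgroups $\{A_\mu\}_{\mu\in \mathrm M}\cup\{K\}$, and let $B$ be a group which is finitely presented relative to a collection of subgroups $\{B_\nu\}_{\nu\in \mathrm N}$. Suppose that the corresponding relative Dehn functions $\gamma_1$ (of $A$) and $\gamma_2$ (of $B$) are well-defined. Assume in addition that $K$ is finitely generated and that for some $\eta\in \mathrm N$ there is a monomorphism $\xi:K\to B_\eta$. Then the amalgamated product $A\ast_{K=\xi(K)}B$ is finitely presented relative to the collection $\{A_\mu\}_{\mu\in \mathrm M}\cup\{B_\nu\}_{\nu\in \mathrm N}$. Moreover, the relative Dehn function $\delta$ of $A\ast_{K=\xi(K)}B$ with respect to $\{A_\mu\}_{\mu\in \mathrm M}\cup\{B_\nu\}_{\nu\in \mathrm N}$ is well-defined and satisfies $$\delta\preceq\overline{\gamma}\circ\overline{\gamma},$$ where $\gamma(n)=\max\{\gamma_1(n),\gamma_2(n)\}$ for all $n\in\mathbb N$ and $\overline{\gamma}$ is the superadditive closure of $\gamma$.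
   Context: $A\ast_{K=\xi(K)}B$ is the free product of $A$ and $B$ amalgamated by identifying each $k\in K\le A$ with $\xi(k)\in B_\eta\le B$. $\mathrm M$ and $\mathrm N$ are index sets. **Relative presentations.** Let $G$ be a group, $\{H_\lambda\}_{\lambda\in\Lambda}$ a collection of subgroups of $G$ and $X\subseteq G$ a subset, always assumed symmetrized ($X^{-1}=X$). $X$ is a relative generating set of $G$ with respect to $\{H_\lambda\}_{\lambda\in\Lambda}$ if $G$ is generated by $X\cup\bigcup_{\lambda}H_\lambda$. Then $G$ is a quotient of the free product $F=(\ast_{\lambda\in\Lambda}H_\lambda)\ast F(X)$, where $F(X)$ is the free group with basis $X$. If the kernel of the natural homomorphism $F\to G$ is the normal closure in $F$ of a subset $\mathcal R$, one says that $G$ has the relative presentation $\langle X, H_\lambda,\lambda\in\Lambda\mid\mathcal R\rangle$. It is finite if $X$ and $\mathcal R$ are finite (there is no finiteness restriction on $\Lambda$ or on the $H_\lambda$); if a finite relative presentation exists, $G$ is said to be finitely presented relative to (with respect to) $\{H_\lambda\}_{\lambda\in\Lambda}$. **Relative Dehn functions.** Put $\mathcal H=\bigsqcup_{\lambda\in\Lambda}(H_\lambda\setminus\{1\})$. For a word $W$ in the alphabet $X\cup\mathcal H$ representing $1$ in $G$, the relative area $Area^{rel}(W)$ is the smallest $k$ such that $W=\prod_{i=1}^k f_i^{-1}R_i^{\pm1}f_i$ in $F$ with $R_i\in\mathcal R$, $f_i\in F$. A function $f:\mathbb N\to\mathbb N$ is a relative isoperimetric function if for every $n$ and every word $W$ in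 $X\cup\mathcal H$ of length at most $n$ representing $1$ in $G$, $Area^{rel}(W)\le f(n)$. The smallest relative isoperimetric function is the relative Dehn function of $G$ with respect to $\{H_\lambda\}_{\lambda\in\Lambda}$; it is well-defined if these relative areas are bounded for each $n$ (this may fail, as there may be infinitely many words of a given length). For a group finitely presented relative to the collection, relative Dehn functions are taken with respect to finite relative presentations; when well-defined, the function does not depend on the finite relative presentation up to the equivalence relation ($f\preceq g$ and $g\preceq f$) defined below. **Comparison.** For $f,g:\mathbb N\to\mathbb N$, write $f\preceq g$ if there are positive constants $a,b,c$ such that $f(n)\le a\,g(bn)+cn$ for all $n$. **Superadditive closure.** $f:\mathbb N\to\mathbb N$ is superadditive if $f(p+q)\ge f(p)+f(q)$ for all $p,q\in\mathbb N$. The superadditive closure of $f$ is $$\overline f(n)=\max_{i=1,\dots,n}\ \max_{a_1+\dots+a_i=n,\ a_j\in\mathbb N}\bigl(f(a_1)+\dots+f(a_i)\bigr),$$ the smallest superadditive function with $\overline f(n)\ge f(n)$ for all $n$ (Dehn functions vanish at $0$, and $\overline f(0)=0$ for them). *)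

(* Defs.v *)
From HB Require Import structures.
From mathcomp Require Import all_boot.
From mathcomp Require Import boolp classical_sets cardinality.
Set Implicit Arguments.
Unset Strict Implicit.
Unset Printing Implicit Defensive.
Local Open Scope group_scope.
Local Open Scope classical_set_scope.

Section Subgroups.
Variable G : groupType.

Definition is_subgroup (H : set G) : Prop :=
  H 1 /\ forall x y, H x -> H y -> H (x / y).

Definition is_normal_subgroup (N : set G) : Prop :=
  is_subgroup N /\ forall x g, N x -> N (x ^ g).

Definition gen_subgroup (S : set G) : set G := smallest is_subgroup S.

Definition normal_closure (S : set G) : set G := smallest is_normal_subgroup S.

Definition finitely_generated (H : set G) : Prop :=
  exists2 Y : set G, finite_set Y & gen_subgroup Y = H.

End Subgroups.

(* The letter (s, false) stands for the generator s and (s, true) for its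
   formal inverse. *)
Definition word (S : Type) : Type := seq (S * bool).
HB.instance Definition _ (S : Type) := gen_eqMixin (word S).
HB.instance Definition _ (S : Type) := gen_choiceMixin (word S).

Section PresentedGroup.
Variables (S : Type) (Rel : set (word S)).
Implicit Types u v w : word S.

Inductive pres_eq : word S -> word S -> Prop :=
| pres_eq_refl u : pres_eq u u
| pres_eq_sym u v : pres_eq u v -> pres_eq v u
| pres_eq_trans u v w : pres_eq u v -> pres_eq v w -> pres_eq u w
| pres_eq_cat u u' v v' :
    pres_eq u u' -> pres_eq v v' -> pres_eq (u ++ v) (u' ++ v')
| pres_eq_cancel s b : pres_eq [:: (s, b); (s, ~~ b)] [::]
| pres_eq_rel r : Rel r -> pres_eq r [::].

Definition pres_eqb u v : bool := `[< pres_eq u v >].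

Fact pres_eqb_refl : reflexive pres_eqb.
Proof. by move=> u; apply/asboolP; exact: pres_eq_refl. Qed.

Fact pres_eqb_sym : symmetric pres_eqb.
Proof. by move=> u v; apply/asboolP/asboolP => /pres_eq_sym. Qed.

Fact pres_eqb_trans : transitive pres_eqb.
Proof.
move=> v u w /asboolP uv /asboolP vw.
by apply/asboolP; exact: pres_eq_trans uv vw.
Qed.

Canonical pres_equiv := EquivRel pres_eqb pres_eqb_refl pres_eqb_sym pres_eqb_trans.

Definition pres_group : Type := {eq_quot pres_equiv}%qT.
HB.instance Definition _ := Choice.on pres_group.
HB.instance Definition _ := EqQuotient.on pres_group.

Definition pres_class (u : word S) : pres_group := (\pi u)%qT.

Lemma pres_classP u v : pres_class u = pres_class v <-> pres_eq u v.
Proof.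
by split=> [/eqquotP/asboolP | uv]; last by apply/eqquotP/asboolP.
Qed.

Lemma pres_reprK (x : pres_group) : pres_class (repr x) = x.
Proof. exact: reprK. Qed.

Definition word_inv u : word S := [seq (l.1, ~~ l.2) | l <- rev u].

Definition pres_mul (x y : pres_group) := pres_class (repr x ++ repr y).
Definition pres_inv (x : pres_group) := pres_class (word_inv (repr x)).

Lemma pres_eq_repr u : pres_eq (repr (pres_class u)) u.
Proof. by apply/pres_classP; exact: pres_reprK. Qed.

Lemma pres_mulE u v :
  pres_mul (pres_class u) (pres_class v) = pres_class (u ++ v).
Proof. by apply/pres_classP/pres_eq_cat; exact: pres_eq_repr. Qed.

Lemma pres_eq_invr u : pres_eq (u ++ word_inv u) [::].
Proof.
rewrite /word_inv; elim: u => [|[s b] u IH] /=; first exact: pres_eq_refl.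
rewrite rev_cons map_rcons -cats1 -cat_cons catA -cat1s -catA -catA.
apply: pres_eq_trans (pres_eq_cancel s b).
rewrite -[[:: (s, b); _]]/([:: (s, b)] ++ ([::] ++ [:: (s, ~~ b)])).
apply: pres_eq_cat; first exact: pres_eq_refl.
by rewrite catA; apply: pres_eq_cat => //; exact: pres_eq_refl.
Qed.

Lemma word_invK : involutive word_inv.
Proof.
move=> u; rewrite /word_inv -map_rev revK -map_comp -[RHS]map_id.
by apply: eq_map => -[s b] /=; rewrite negbK.
Qed.

Fact pres_mulA : associative pres_mul.
Proof.
move=> x y z; rewrite -(pres_reprK x) -(pres_reprK y) -(pres_reprK z).
by rewrite !pres_mulE catA.
Qed.

Fact pres_mul1g : left_id (pres_class [::]) pres_mul.
Proof. by move=> x; rewrite -(pres_reprK x) pres_mulE. Qed.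

Fact pres_mulg1 : right_id (pres_class [::]) pres_mul.
Proof. by move=> x; rewrite -(pres_reprK x) pres_mulE cats0. Qed.

Fact pres_mulgV : right_inverse (pres_class [::]) pres_inv pres_mul.
Proof.
move=> x; rewrite -{1}(pres_reprK x) pres_mulE.
by apply/pres_classP; exact: pres_eq_invr.
Qed.

Fact pres_mulVg : left_inverse (pres_class [::]) pres_inv pres_mul.
Proof.
move=> x; rewrite -{2}(pres_reprK x) pres_mulE; apply/pres_classP.
by rewrite -{2}[repr x]word_invK; exact: pres_eq_invr.
Qed.

HB.instance Definition _ := isGroup.Build pres_group
  pres_mulA pres_mul1g pres_mulg1 pres_mulVg pres_mulgV.

Definition pres_gen (s : S) : pres_group := pres_class [:: (s, false)].

Section Lift.
Variables (G : groupType) (f : S -> G).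

Definition word_eval (u : word S) : G :=
  \prod_(l <- u) (if l.2 then (f l.1)^-1 else f l.1).

(* The homomorphism extending f; meaningful when f kills Rel, see
   pres_lift_class and pres_liftM. *)
Definition pres_lift (x : pres_group) : G := word_eval (repr x).

Hypothesis fRel : forall r, Rel r -> word_eval r = 1.

Lemma pres_lift_class u : pres_lift (pres_class u) = word_eval u.
Proof.
suff eval_eq v w : pres_eq v w -> word_eval v = word_eval w.
  exact/eval_eq/pres_eq_repr.
elim=> {v w} //.
- by move=> x y z _ -> _ ->.
- move=> v v' w w' _ IH1 _ IH2.
  by rewrite /word_eval !big_cat /= -!/(word_eval _) IH1 IH2.
- move=> s b; rewrite /word_eval !big_cons !big_nil /= mulg1.
  by case: b; rewrite /= ?mulVg ?mulgV.
- by move=> r /fRel ->; rewrite /word_eval big_nil.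
Qed.

Lemma pres_liftM : {morph pres_lift : x y / x * y}.
Proof.
move=> x y; rewrite -(pres_reprK x) -(pres_reprK y).
by rewrite [_ * _]pres_mulE !pres_lift_class /word_eval big_cat.
Qed.

End Lift.
End PresentedGroup.

Section Amalgam.
Variables (A B : groupType) (K : set A) (xi : A -> B).

Inductive amalgam_rel : set (word (A + B)) :=
| amalgam_rel_l x y : amalgam_rel
    [:: (inl x, false); (inl y, false); (inl (x * y), true)]
| amalgam_rel_r x y : amalgam_rel
    [:: (inr x, false); (inr y, false); (inr (x * y), true)]
| amalgam_rel_K k : K k -> amalgam_rel
    [:: (inl k, false); (inr (xi k), true)].

Definition amalgam : groupType := pres_group amalgam_rel.

Definition amalgam_inl (x : A) : amalgam := pres_gen amalgam_rel (inl x).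
Definition amalgam_inr (y : B) : amalgam := pres_gen amalgam_rel (inr y).

End Amalgam.

Section Relative.
Variables (G : groupType) (L : Type) (H : L -> set G).

Section FreeProduct.
Variable X : set G.

(* The relators are the multiplication tables of the factors H l, so that the
   group below is the free product of the H l and of the free group with
   basis X. The formal inverse of x in X is distinct from x^-1 in X. *)
Inductive rel_free_rel : set (word (X + {l : L & H l})) :=
| Rel_free_rel l (h k m : H l) : val h * val k = val m -> rel_free_rel
    [:: (inr (existT _ l h), false); (inr (existT _ l k), false);
        (inr (existT _ l m), true)].

Definition rel_free : groupType := pres_group rel_free_rel.

Definition rel_gen_val (s : X + {l : L & H l}) : G :=
  match s with inl x => val x | inr h => val (projT2 h) end.

Definition rel_free_hom : rel_free -> G :=
  @pres_lift _ rel_free_rel G rel_gen_val.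

Fact rel_free_hom_rel r : rel_free_rel r -> word_eval rel_gen_val r = 1.
Proof.
case=> l h k m hkm; rewrite /word_eval !big_cons big_nil /= mulg1.
by rewrite mulgA hkm mulgV.
Qed.

Lemma rel_free_homM : {morph rel_free_hom : x y / x * y}.
Proof. by apply: pres_liftM; exact: rel_free_hom_rel. Qed.

Lemma rel_free_hom_gen s :
  rel_free_hom (pres_gen rel_free_rel s) = rel_gen_val s.
Proof.
rewrite [LHS]pres_lift_class; last exact: rel_free_hom_rel.
by rewrite /word_eval big_seq1.
Qed.

Definition rel_letter : Type := X + {l : L & H l `\ (1 : G)}.

Definition rel_letter_free (s : rel_letter) : rel_free :=
  pres_gen rel_free_rel
    match s with
    | inl x => inl x
    | inr (existT l h) =>
        inr (existT _ l (SigSub (mem_set (set_mem (valP h)).1)))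
    end.

Definition rel_word_free (W : seq rel_letter) : rel_free :=
  \prod_(s <- W) rel_letter_free s.

End FreeProduct.

Definition rel_presentation (X : set G) (R : set (rel_free X)) : Prop :=
  [/\ forall x, X x -> X x^-1,
      gen_subgroup (X `|` \bigcup_l H l) = setT
    & [set w | rel_free_hom w = 1] = normal_closure R].

Definition finite_rel_presentation (X : set G) (R : set (rel_free X)) : Prop :=
  [/\ rel_presentation R, finite_set X & finite_set R].

Definition finitely_presented_rel : Prop :=
  exists (X : set G) (R : set (rel_free X)), finite_rel_presentation R.

Section Dehn.
Variables (X : set G) (R : set (rel_free X)).

Definition prod_conj_relators (k : nat) (w : rel_free X) : Prop :=
  exists (f r : 'I_k -> rel_free X) (e : 'I_k -> bool),
    (forall i, R (r i)) /\
    w = \prod_(i < k) (if e i then (r i)^-1 else r i) ^ f i.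

Definition is_rel_area (W : seq (rel_letter X)) (k : nat) : Prop :=
  prod_conj_relators k (rel_word_free W) /\
  forall j, prod_conj_relators j (rel_word_free W) -> (k <= j)%N.

Definition rel_isoperimetric (f : nat -> nat) : Prop :=
  forall (n : nat) (W : seq (rel_letter X)),
    (size W <= n)%N -> rel_free_hom (rel_word_free W) = 1 ->
    exists2 k, is_rel_area W k & (k <= f n)%N.

Definition is_rel_Dehn (f : nat -> nat) : Prop :=
  rel_isoperimetric f /\
  forall g, rel_isoperimetric g -> forall n, (f n <= g n)%N.

End Dehn.
End Relative.

Definition asymp_le (f g : nat -> nat) : Prop :=
  exists a b c : nat, [/\ 0 < a, 0 < b & 0 < c]%N /\
    forall n, (f n <= a * g (b * n) + c * n)%N.

Definition superadditive_closure (f : nat -> nat) (n : nat) : nat :=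
  (\max_(1 <= i < n.+1)
    \max_(a : {ffun 'I_i -> 'I_n.+1} | \sum_(j < i) a j == n)
      \sum_(j < i) f (a j))%N.

Definition add_subgroup (G : groupType) (M : Type) (H : M -> set G)
  (K : set G) (m : option M) : set G := if m is Some i then H i else K.

Definition union_family (T M N : Type) (H1 : M -> set T) (H2 : N -> set T)
  (i : M + N) : set T :=
  match i with inl m => H1 m | inr n => H2 n end.

(* Main.v *)
(* Write G for the amalgam. Since xi K lies in the factor B_eta, a letter k of
   K can be traded for the single letter xi k, so lifting the two given
   presentations along their generators maps relators of A and of B to elements
   of bounded area over any finite relative presentation of G. Cut a word that
   is trivial in G into syllables, each in the letters of A or of B. If two
   neighbouring syllables are on the same side, merge them. Otherwise, by the
   normal form theorem some syllable of length l represents an element of K; it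
   equals a single letter on the other side, and this is certified by a relation
   of length at most l + 1 in A or B, at cost O(gamma (l + 1)). The potential
   (total length) + 2 (number of syllables) drops by at least l + 1 at
   each such step, so superadditivity bounds the total cost by
   O(gbar (3 n)), gbar being the superadditive closure. This is at most
   gbar (gbar (b n)) up to constants, because gbar (k n) >= n as soon as
   gbar k > 0.
   The normal form theorem is van der Waerden's: both factors act, compatibly
   on K, on pairs of an element of K and an alternating list of coset
   representatives. *)
Require Import Defs.
From HB Require Import structures.
From mathcomp Require Import all_boot.
From mathcomp Require Import boolp classical_sets cardinality.
Set Implicit Arguments.
Unset Strict Implicit.
Unset Printing Implicit Defensive.
Local Open Scope group_scope.
Local Open Scope classical_set_scope.

(** * Superadditive closures *)

Section SuperadditiveClosure.
Variable f : nat -> nat.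
Local Notation fbar := (superadditive_closure f).

(** Lists of parts replace the functions ['I_i -> 'I_n.+1], so that superadditivity becomes
    concatenation of lists. The bound on [size s] is a genuine constraint, since zero parts are
    allowed and [f 0] is arbitrary here. *)
Lemma superadditive_closure_ge (n : nat) (s : seq nat) :
  (size s <= n)%N -> sumn s = n -> (\sum_(x <- s) f x <= fbar n)%N.
Proof.
case: s => [|x s] sn sumE; first by rewrite big_nil.
move: (x :: s) (isT : 0 < size (x :: s))%N sn sumE => {x}s s0 sn sumE.
have lt_s (j : 'I_(size s)) : (nth 0 s j < n.+1)%N.
  rewrite ltnS -sumE sumnE (big_nth 0) big_mkord (bigD1 j) //=.
  exact: leq_addr.
rewrite /superadditive_closure.
apply: leq_trans (leq_bigmax_seq
  (F := fun i => (\max_(a : {ffun 'I_i -> 'I_n.+1} | \sum_(j < i) a j == n)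
      \sum_(j < i) f (a j))%N) (size s) _ _) => //; last first.
  by rewrite mem_index_iota s0 ltnS.
set a := [ffun j : 'I_(size s) => inord (nth 0 s j) : 'I_n.+1].
have aE j : a j = nth 0 s j :> nat by rewrite ffunE inordK.
have sa : (\sum_(j < size s) a j == n)%N.
  rewrite -[X in _ == X]sumE sumnE (big_nth 0) big_mkord.
  by apply/eqP; apply: eq_bigr => j _; exact: aE.
apply: leq_trans (leq_bigmax_cond (F := fun a : {ffun 'I_(size s) -> 'I_n.+1} =>
  (\sum_(j < size s) f (a j))%N) a sa).
rewrite (big_nth 0) big_mkord leq_eqVlt; apply/orP; left; apply/eqP.
by apply: eq_bigr => j _; rewrite aE.
Qed.

(** The values bounded by some such sum contain 0 and are closed under [maxn], which lets both
    nested maxima be treated by induction on the big operator. *)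
Lemma superadditive_closure_attained (n : nat) :
  exists s : seq nat,
    [/\ size s <= n, sumn s = n & fbar n <= \sum_(x <- s) f x]%N.
Proof.
pose Q v := exists s : seq nat,
  [/\ size s <= n, sumn s = n & v <= \sum_(x <- s) f x]%N.
have Q0 : Q 0.
  rewrite /Q; case: (posnP n) => [->|n0]; first by exists [::].
  by exists [:: n]; split => //=; rewrite addn0.
have Qmax u v : Q u -> Q v -> Q (maxn u v).
  by move=> Qu Qv; rewrite /maxn; case: ifP.
rewrite -[exists _, _]/(Q (fbar n)) /superadditive_closure big_seq.
apply: big_ind => // i; rewrite mem_index_iota ltnS => /andP[i0 le_in].
apply: big_ind => // a /eqP sa.
exists [seq nat_of_ord (a j) | j <- enum 'I_i].
rewrite size_map size_enum_ord sumnE !big_map; split => //.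
Qed.

Lemma superadditive_closureD (p q : nat) :
  (fbar p + fbar q <= fbar (p + q))%N.
Proof.
have [s [s1 s2 s3]] := superadditive_closure_attained p.
have [t [t1 t2 t3]] := superadditive_closure_attained q.
apply: leq_trans (leq_add s3 t3) _.
rewrite -big_cat; apply: superadditive_closure_ge.
  by rewrite size_cat leq_add.
by rewrite sumn_cat s2 t2.
Qed.

Lemma leq_superadditive_closure (m n : nat) :
  (m <= n)%N -> (fbar m <= fbar n)%N.
Proof.
move=> /subnKC <-.
by apply: leq_trans (superadditive_closureD _ _); exact: leq_addr.
Qed.

Lemma superadditive_closure_id (n : nat) : (0 < n)%N -> (f n <= fbar n)%N.
Proof.
move=> n0; have := @superadditive_closure_ge n [:: n].
by rewrite big_seq1 /= addn0; apply.
Qed.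

Lemma superadditive_closure_mul (k n : nat) :
  (n * fbar k <= fbar (n * k))%N.
Proof.
elim: n => // n IH; rewrite !mulSn.
by apply: leq_trans (superadditive_closureD _ _); rewrite leq_add2l.
Qed.

Lemma asymp_le_comp_superadditive_closure (g : nat -> nat) (a b c : nat) :
  (forall n, g n <= a * fbar (b * n) + c * n)%N ->
  asymp_le g (fbar \o fbar).
Proof.
move=> gle; case: (pselect (exists k, 0 < fbar k)%N) => [[k k0]|fbar0].
(* The successors only keep the constants positive; the factor [fbar k], at least 1, is inserted
   next to [b.+1 * n] and then absorbed into an outer value of [fbar]. *)
- exists a.+1, (b.+1 * k.+1)%N, c.+1; split => // n.
  apply: leq_trans (gle n) _; apply: leq_add; last by rewrite leq_mul.
  apply: leq_mul => //=; apply: leq_superadditive_closure.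
  apply: (@leq_trans (b.+1 * n * fbar k)).
    by rewrite -[leqLHS]muln1 leq_mul // leq_mul.
  apply: leq_trans (superadditive_closure_mul _ _) _.
  apply: leq_superadditive_closure.
  by rewrite -!mulnA leq_mul // mulnC leq_mul.
(* Here [fbar] vanishes identically, so [g] is at most linear and the term [c.+1 * n] alone bounds
   it. *)
- exists 1%N, 1%N, c.+1; split => // n; apply: leq_trans (gle n) _.
  have -> : fbar (b * n) = 0%N.
    apply/eqP; rewrite -leqn0 leqNgt; apply/negP => h.
    by apply: fbar0; exists (b * n)%N.
  by rewrite muln0 add0n; apply: leq_trans (leq_addl _ _); rewrite leq_mul.
Qed.

End SuperadditiveClosure.

(** * Areas *)

Section Area.
Variable F : groupType.
Implicit Types (R : set F) (u v w : F).

(* Upper bounds on areas: products of at most n conjugates of relators, see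
   area_le_prod_conj. *)
Inductive area_le R : nat -> F -> Prop :=
| area_le0 n : area_le R n 1
| area_leS n w r f (e : bool) : R r -> area_le R n w ->
    area_le R n.+1 ((if e then r^-1 else r) ^ f * w).

Lemma area_leW R m n u : (m <= n)%N -> area_le R m u -> area_le R n u.
Proof.
move=> mn h; elim: h n mn => {m u} [m|m u r f e Rr _ IH] [|n] // mn.
- exact: area_le0.
- exact: area_le0.
- by apply: area_leS => //; exact: IH.
Qed.

Lemma area_leM R m n u v :
  area_le R m u -> area_le R n v -> area_le R (m + n) (u * v).
Proof.
elim=> {m u} [m|m u r f e Rr _ IH] h.
  by rewrite mul1g; apply: area_leW h; exact: leq_addl.
by rewrite -mulgA addSn; apply: area_leS => //; exact: IH.
Qed.

Lemma area_leJ R n u g : area_le R n u -> area_le R n (u ^ g).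
Proof.
elim=> {n u} [n|n u r f e Rr _ IH]; first by rewrite conj1g; exact: area_le0.
by rewrite conjMg -conjgM; exact: area_leS.
Qed.

Lemma area_leV R n u : area_le R n u -> area_le R n u^-1.
Proof.
elim=> {n u} [n|n u r f e Rr _ IH]; first by rewrite invg1; exact: area_le0.
rewrite invgM -[X in area_le R X _]addn1; apply: area_leM => //.
rewrite -conjVg -[_ ^ f]mulg1.
have -> : (if e then r^-1 else r)^-1 = if ~~ e then r^-1 else r.
  by case: e; rewrite ?invgK.
by apply: area_leS => //; exact: area_le0.
Qed.

Lemma area_le_rel R r : R r -> area_le R 1 r.
Proof.
move=> Rr; have := @area_leS R 0 1 r 1 false Rr (area_le0 R 0).
by rewrite conjg1 mulg1.
Qed.

(** Replacing a factor u by v inside a product changes it by a conjugate of [u / v], and areas are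
    invariant under conjugation. *)
Lemma area_le_div R n u v g h :
  area_le R n (u / v) -> area_le R n ((g * u * h) / (g * v * h)).
Proof.
move=> /(@area_leJ _ _ _ g^-1).
suff -> : (u / v) ^ g^-1 = g * u * h / (g * v * h) by [].
by rewrite conjgE invgK !invgM !mulgA mulgK.
Qed.

Lemma area_le_trans R m n u v w :
  area_le R m (u / v) -> area_le R n (v / w) -> area_le R (m + n) (u / w).
Proof. by move=> h /(area_leM h); rewrite mulgA mulgVK. Qed.

Lemma area_le_divM R m n u u' v v' :
  area_le R m (u / u') -> area_le R n (v / v') ->
  area_le R (m + n) ((u * v) / (u' * v')).
Proof.
move=> /(@area_le_div _ _ _ _ 1 v); rewrite !mul1g => uu'.
move=> /(@area_le_div _ _ _ _ u' 1); rewrite !mulg1; exact: area_le_trans.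
Qed.

(** The elements of finite area form a normal subgroup containing [R]; conversely every normal
    subgroup containing [R] contains all products of conjugates of relators. *)
Lemma area_le_normal_closure R u :
  normal_closure R u <-> exists n, area_le R n u.
Proof.
split=> [|[n]].
  move=> /(_ [set v | exists n, area_le R n v]); apply.
  split; last by move=> r Rr; exists 1%N; exact: area_le_rel.
  split; last by move=> x g [n xn]; exists n; exact: area_leJ.
  split; first by exists 0%N; exact: area_le0.
  move=> x y [m xm] [n yn]; exists (m + n)%N; apply: area_leM => //.
  exact: area_leV.
move=> uR N [[[N1 Nd] NJ] RN].
have NV x : N x -> N x^-1 by rewrite -(mul1g x^-1); exact: Nd.
elim: uR => {n u} [//|n u r f e Rr _ IH].
rewrite -[u]invgK; apply: Nd; last exact: NV.
by apply: NJ; case: e; last exact: RN; apply: NV; exact: RN.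
Qed.

End Area.

(** * Homomorphisms and their effect on areas *)

Section Morphisms.
Variables (F F' : groupType) (phi : F -> F').
Hypothesis phiM : {morph phi : x y / x * y}.

Lemma morph1 : phi 1 = 1.
Proof. by apply: (mulgI (phi 1)); rewrite -phiM !mulg1. Qed.

Lemma morphV x : phi x^-1 = (phi x)^-1.
Proof. by apply: (mulgI (phi x)); rewrite -phiM !mulgV morph1. Qed.

Lemma morph_prod (I : Type) (s : seq I) (f : I -> F) :
  phi (\prod_(i <- s) f i) = \prod_(i <- s) phi (f i).
Proof. exact: (big_morph phi phiM morph1). Qed.

End Morphisms.

Lemma area_le_morph (F F' : groupType) (R : set F) (R' : set F')
    (phi : F -> F') a n u :
  {morph phi : x y / x * y} -> (forall r, R r -> area_le R' a (phi r)) ->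
  area_le R n u -> area_le R' (a * n) (phi u).
Proof.
move=> phiM phiR; have phiV := morphV phiM.
elim=> {n u} [n|n u r f e Rr _ IH].
  by rewrite (morph1 phiM); exact: area_le0.
rewrite phiM mulnS; apply: area_leM => //.
rewrite conjgE !phiM phiV -conjgE; apply: area_leJ.
by case: e; rewrite ?phiV; first apply: area_leV; exact: phiR.
Qed.

(** [prod_conj_relators] counts its factors exactly, and a product cannot in general be padded to a
    prescribed length; hence the auxiliary j below n. *)
Lemma area_le_prod_conj (G : groupType) (L : Type) (H : L -> set G)
    (X : set G) (R : set (rel_free H X)) n u :
  area_le R n u <-> exists2 j, (j <= n)%N & prod_conj_relators R j u.
Proof.
split.
  elim=> {n u} [n|n u r f e Rr _ [j jn [fs [rs [es [Rs ->]]]]]].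
    exists 0%N => //; exists (fun=> 1), (fun=> 1), (fun=> false).
    by split; [case | rewrite big_ord0].
  exists j.+1 => //.
  pose ext T (x : T) (g : 'I_j -> T) (i : 'I_j.+1) :=
    if unlift ord0 i is Some i' then g i' else x.
  exists (ext _ f fs), (ext _ r rs), (ext _ e es); split.
    by move=> i; rewrite /ext; case: unliftP.
  rewrite big_ord_recl /ext unlift_none; congr (_ * _).
  by apply: eq_bigr => i _; rewrite liftK.
case=> j jn [fs [rs [es [Rs ->]]]]; apply: (area_leW jn).
elim: j {jn} fs rs es Rs => [|j IH] fs rs es Rs.
  by rewrite big_ord0; exact: area_le0.
rewrite big_ord_recl; apply: area_leS => //.
by apply: (IH (fs \o lift ord0) (rs \o lift ord0) (es \o lift ord0)) => i /=.
Qed.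

(** Turns finiteness of the sets of relators and generators into uniform constants. *)
Lemma finite_set_bound (T : eqType) (S : set T) (P : T -> nat -> Prop) :
  finite_set S -> (forall t m n, (m <= n)%N -> P t m -> P t n) ->
  (forall t, S t -> exists n, P t n) ->
  exists n, forall t, S t -> P t n.
Proof.
move=> /finite_seqP[s ->] Pmono; elim: s => [|t s IH] sP; first by exists 0%N.
have [m tm] := sP t (mem_head t s).
have [|n sn] := IH; first by move=> u us; apply: sP; rewrite /= in_cons us orbT.
exists (maxn m n) => u /=; rewrite in_cons => /orP[/eqP->|us].
  by apply: Pmono tm; exact: leq_maxl.
by apply: Pmono (sn u us); exact: leq_maxr.
Qed.


(** * Free products and their homomorphisms *)

Section Subgroup.
Variables (A : groupType) (K : set A).
Hypothesis subK : is_subgroup K.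

Lemma is_subgroup1 : K 1. Proof. exact: subK.1. Qed.

Lemma is_subgroupV k : K k -> K k^-1.
Proof. by move=> Kk; rewrite -(mul1g k^-1); apply: subK.2 => //; case: subK. Qed.

Lemma is_subgroupM k k' : K k -> K k' -> K (k * k').
Proof. by move=> Kk Kk'; rewrite -[k']invgK; apply/subK.2/is_subgroupV. Qed.

End Subgroup.

Section PresentedGroupTheory.
Variables (S : Type) (Rel : set (word S)).
Local Notation gen := (pres_gen Rel).

Lemma pres_class_eval u : pres_class Rel u = word_eval gen u.
Proof.
rewrite /word_eval; elim: u => [|[s b] u IH]; first by rewrite big_nil.
rewrite big_cons /= -IH -cat1s -pres_mulE; congr (_ * _); case: b => //.
apply/esym/mulg1_eq; rewrite [LHS]pres_mulE.
by apply/pres_classP; exact: (pres_eq_cancel Rel s false).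
Qed.

Lemma word_eval_rel r : Rel r -> word_eval gen r = 1.
Proof. by move=> Rr; rewrite -pres_class_eval; apply/pres_classP/pres_eq_rel. Qed.

Lemma pres_gen_rel2 s t : Rel [:: (s, false); (t, true)] -> gen s = gen t.
Proof.
by move=> /word_eval_rel; rewrite /word_eval !big_cons big_nil mulg1 => /divg1_eq.
Qed.

Lemma pres_gen_rel3 s t u :
  Rel [:: (s, false); (t, false); (u, true)] -> gen s * gen t = gen u.
Proof.
move=> /word_eval_rel; rewrite /word_eval !big_cons big_nil mulg1 mulgA.
exact: divg1_eq.
Qed.

Lemma pres_group_ind (P : pres_group Rel -> Prop) :
  P 1 -> (forall s x, P x -> P (gen s * x)) ->
  (forall s x, P x -> P ((gen s)^-1 * x)) -> forall x, P x.
Proof.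
move=> P1 Pg PV x; rewrite -(pres_reprK x) pres_class_eval /word_eval.
elim: (repr x) => [|[s b] u IH]; first by rewrite big_nil.
by rewrite big_cons; case: b => /=; [exact: PV | exact: Pg].
Qed.

End PresentedGroupTheory.

(** * Generators, words and universal property of the relative free group *)

Section RelFree.
Variables (G : groupType) (L : Type) (H : L -> set G) (X : set G).
Hypothesis subH : forall l, is_subgroup (H l).

(** Unlike the letters of [rel_letter], this allows g = 1, which makes multiplication within a
    factor uniform. *)
Definition factor_gen l g (Hg : H l g) : rel_free H X :=
  pres_gen (@rel_free_rel _ _ H X)
    (inr (existT (fun l => H l) l (SigSub (mem_set Hg)))).

Definition basis_gen (x : X) : rel_free H X :=
  pres_gen (@rel_free_rel _ _ H X) (inl x).

Lemma eq_factor_gen l g g' (Hg : H l g) (Hg' : H l g') :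
  g = g' -> factor_gen Hg = factor_gen Hg'.
Proof. by move=> gg'; subst g'; rewrite (Prop_irrelevance Hg Hg'). Qed.

Lemma factor_genM l g h k (Hg : H l g) (Hh : H l h) (Hk : H l k) :
  g * h = k -> factor_gen Hg * factor_gen Hh = factor_gen Hk.
Proof. by move=> ghk; apply: pres_gen_rel3; exact: Rel_free_rel. Qed.

Lemma factor_gen1 l (H1 : H l 1) : factor_gen H1 = 1.
Proof.
by apply: (mulgI (factor_gen H1)); rewrite (factor_genM H1 H1 H1) mulg1.
Qed.

Lemma factor_genV l g (Hg : H l g) (HgV : H l g^-1) :
  factor_gen HgV = (factor_gen Hg)^-1.
Proof.
have H1 := is_subgroup1 (subH l).
by apply/esym/mulg1_eq; rewrite (factor_genM Hg HgV H1) ?mulgV // factor_gen1.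
Qed.

Lemma rel_free_hom_factor_gen l g (Hg : H l g) :
  rel_free_hom (factor_gen Hg) = g.
Proof. exact: rel_free_hom_gen. Qed.

Lemma rel_free_hom_basis_gen x : rel_free_hom (basis_gen x) = val x.
Proof. exact: rel_free_hom_gen. Qed.

(** Only basis letters need a case for formal inverses: the inverse of a factor letter is again a
    letter of that factor. *)
Lemma rel_free_ind (P : rel_free H X -> Prop) :
  P 1 ->
  (forall x u, P u -> P (basis_gen x * u)) ->
  (forall x u, P u -> P ((basis_gen x)^-1 * u)) ->
  (forall l g (Hg : H l g) u, P u -> P (factor_gen Hg * u)) ->
  forall u, P u.
Proof.
move=> P1 PX PXV PH.
have PH' l (h : H l) u : P u ->
    P (pres_gen (@rel_free_rel _ _ H X) (inr (existT _ l h)) * u).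
  have -> : h = SigSub (mem_set (set_mem (valP h))) by apply: val_inj.
  exact: PH.
apply: pres_group_ind => // -[x|[l h]] u Pu; [exact: PX|exact: PH'|exact: PXV|].
have HV : H l (val h)^-1 by apply: (is_subgroupV (subH l)); exact: set_mem (valP h).
rewrite -[X in X^-1]/(pres_gen _ _).
have -> : h = SigSub (mem_set (set_mem (valP h))) by apply: val_inj.
by rewrite -[(pres_gen _ _)^-1](factor_genV _ HV); exact: PH.
Qed.

(** The length is 0 rather than 1 when g = 1, because 1 is not a letter of a relative word. *)
Lemma factor_gen_word l g (Hg : H l g) :
  exists2 w : seq (rel_letter H X), (size w <= 1)%N &
    rel_word_free w = factor_gen Hg.
Proof.
case: (pselect (g = 1)) => [g1|g1].
  exists [::] => //; subst g; rewrite factor_gen1 /rel_word_free big_nil //.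
have H1g : (H l `\ (1 : G)) g by split.
exists [:: inr (existT _ l (SigSub (mem_set H1g)))] => //.
by rewrite /rel_word_free big_seq1; exact: eq_factor_gen.
Qed.

Lemma rel_letter_freeP (s : rel_letter H X) :
  (exists x, rel_letter_free s = basis_gen x) \/
  (exists l g (Hg : H l g), rel_letter_free s = factor_gen Hg).
Proof. by case: s => [x|[l h]]; [left; exists x | right; do 3 eexists]. Qed.

Lemma rel_word_free_cat (u v : seq (rel_letter H X)) :
  rel_word_free (u ++ v) = rel_word_free u * rel_word_free v.
Proof. exact: big_cat. Qed.

(** Relative words have no formal inverse letters. Inverses are found in [G] instead, from the
    symmetry of [X] and the subgroup property of the [H l]. *)
Lemma rel_word_surj :
  (forall x, X x -> X x^-1) -> gen_subgroup (X `|` \bigcup_l H l) = setT ->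
  forall g, exists W : seq (rel_letter H X), rel_free_hom (rel_word_free W) = g.
Proof.
move=> XV genX g; have homM := @rel_free_homM _ _ H X.
have hom1 := morph1 homM; have homV := morphV homM.
pose S := [set g | exists W : seq (rel_letter H X),
  rel_free_hom (rel_word_free W) = g].
have SM x y : S x -> S y -> S (x * y).
  move=> [U <-] [V <-]; exists (U ++ V).
  by rewrite rel_word_free_cat homM.
have SX x : X x -> S x.
  move=> Xx; exists [:: inl (SigSub (mem_set Xx))].
  by rewrite /rel_word_free big_seq1; exact: rel_free_hom_basis_gen.
have SH l h : H l h -> S h.
  move=> Hh; have [w _ wE] := factor_gen_word Hh.
  by exists w; rewrite wE rel_free_hom_factor_gen.
have S1 : S 1 by exists [::]; rewrite /rel_word_free big_nil hom1.
have SV x : S x -> S x^-1.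
  move=> [W <-] {x}; elim: W => [|s W IH]; first by
    rewrite /rel_word_free big_nil hom1 invg1.
  rewrite -cat1s rel_word_free_cat homM invgM; apply: SM => //.
  rewrite /rel_word_free big_seq1.
  have [[y ->]|[l [h [Hh ->]]]] := rel_letter_freeP s.
    by rewrite rel_free_hom_basis_gen; apply/SX/XV; exact: set_mem (valP y).
  by rewrite rel_free_hom_factor_gen; apply: (SH l); exact: (is_subgroupV (subH l)).
have : gen_subgroup (X `|` \bigcup_l H l) g by rewrite genX.
move=> /(_ S); apply; split.
  by split => // x y Sx Sy; apply: SM => //; exact: SV.
by move=> x [/SX//|[l _ /SH]].
Qed.

Section Lift.
Variables (F : groupType) (fX : X -> F) (fH : forall l g, H l g -> F).
Hypothesis fHM : forall l g h k (Hg : H l g) (Hh : H l h) (Hk : H l k),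
  g * h = k -> fH Hg * fH Hh = fH Hk.

Definition rel_free_lift : rel_free H X -> F :=
  pres_lift (fun s : X + {l : L & H l} => match s with
    | inl x => fX x
    | inr h => fH (set_mem (valP (projT2 h)))
    end).

Let lift_rel r : @rel_free_rel _ _ H X r ->
  word_eval (fun s : X + {l : L & H l} => match s with
    | inl x => fX x
    | inr h => fH (set_mem (valP (projT2 h)))
    end) r = 1.
Proof.
case=> l h k m hkm; rewrite /word_eval !big_cons big_nil /= mulg1 mulgA.
by rewrite (fHM _ _ (set_mem (valP m)) hkm) mulgV.
Qed.

Lemma rel_free_liftM : {morph rel_free_lift : x y / x * y}.
Proof. exact: pres_liftM. Qed.

Lemma rel_free_lift_basis x : rel_free_lift (basis_gen x) = fX x.
Proof.
by rewrite [LHS]pres_lift_class; [rewrite /word_eval big_seq1 | exact: lift_rel].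
Qed.

Lemma rel_free_lift_factor l g (Hg : H l g) : rel_free_lift (factor_gen Hg) = fH Hg.
Proof.
rewrite [LHS]pres_lift_class; last exact: lift_rel.
by rewrite /word_eval big_seq1 /=; congr fH; exact: Prop_irrelevance.
Qed.

End Lift.

(** * Areas and Dehn functions of a relative presentation *)

Section RelatorArea.
Variable R : set (rel_free H X).

Lemma rel_isoperimetric_area_le f n W : rel_isoperimetric R f ->
  (size W <= n)%N -> rel_free_hom (rel_word_free W) = 1 ->
  area_le R (f n) (rel_word_free W).
Proof.
move=> iso Wn W1; have [k [kW _] kf] := iso n W Wn W1.
by apply/area_le_prod_conj; exists k.
Qed.

Lemma area_le_rel_free_hom n u : (forall r, R r -> rel_free_hom r = 1) ->
  area_le R n u -> rel_free_hom u = 1.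
Proof.
move=> R1; have homM := @rel_free_homM _ _ H X.
elim=> {n u} [n|n u r f e Rr _ IH]; first exact: morph1.
rewrite homM IH mulg1 !homM !(morphV homM).
have -> : rel_free_hom (if e then r^-1 else r) = 1.
  by case: e; rewrite ?(morphV homM) R1 ?invg1.
by rewrite mul1g mulVg.
Qed.

Lemma area_le_rel_free_hom_eq n u v : (forall r, R r -> rel_free_hom r = 1) ->
  area_le R n (u / v) -> rel_free_hom u = rel_free_hom v.
Proof.
move=> R1 /(area_le_rel_free_hom R1).
by rewrite rel_free_homM (morphV (@rel_free_homM _ _ H X)) => /divg1_eq.
Qed.

Lemma rel_presentation_rel1 : rel_presentation R ->
  forall r, R r -> rel_free_hom r = 1.
Proof.
move=> [_ _ kerR] r Rr; have : normal_closure R r by move=> N [_]; exact.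
by rewrite -kerR.
Qed.

Lemma rel_presentation_area u : rel_presentation R -> rel_free_hom u = 1 ->
  exists n, area_le R n u.
Proof. by move=> [_ _ kerR] u1; apply/area_le_normal_closure; rewrite -kerR. Qed.

(** The value at n is the least uniform bound on the areas of trivial words of length at most n; [b]
    shows that such a bound exists, and minimality puts it below every isoperimetric function. *)
Lemma is_rel_Dehn_exists (b : nat -> nat) :
  (forall n W, (size W <= n)%N -> rel_free_hom (rel_word_free W) = 1 ->
     area_le R (b n) (rel_word_free W)) ->
  exists2 delta, is_rel_Dehn R delta & forall n, (delta n <= b n)%N.
Proof.
move=> bR.
pose P n m := `[< forall W, (size W <= n)%N -> rel_free_hom (rel_word_free W) = 1 ->
     area_le R m (rel_word_free W) >].
have exP n : exists m, P n m by exists (b n); apply/asboolP; exact: bR.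
exists (fun n => ex_minn (exP n)); last first.
  by move=> n; case: ex_minnP => m _; apply; apply/asboolP; exact: bR.
split.
  move=> n W Wn W1; case: ex_minnP => m /asboolP Pm _.
  have /area_le_prod_conj[j jm jW] := Pm W Wn W1.
  have exj : exists j, `[< prod_conj_relators R j (rel_word_free W) >].
    by exists j; apply/asboolP.
  case: (ex_minnP exj) => k /asboolP kW kmin.
  exists k; first by split => // i /asboolP; exact: kmin.
  by apply: leq_trans jm; apply: kmin; apply/asboolP.
move=> g iso n; case: ex_minnP => m _; apply; apply/asboolP => W.
exact: rel_isoperimetric_area_le.
Qed.

End RelatorArea.
End RelFree.

Section AmalgamGenerators.
Variables (A B : groupType) (K : set A) (xi : A -> B).

Lemma amalgam_inlM : {morph amalgam_inl K xi : x y / x * y}.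
Proof. by move=> x y; apply/esym/pres_gen_rel3/amalgam_rel_l. Qed.

Lemma amalgam_inrM : {morph amalgam_inr K xi : x y / x * y}.
Proof. by move=> x y; apply/esym/pres_gen_rel3/amalgam_rel_r. Qed.

Lemma amalgam_inlE k : K k -> amalgam_inl K xi k = amalgam_inr K xi (xi k).
Proof. by move=> Kk; apply/pres_gen_rel2/amalgam_rel_K. Qed.

End AmalgamGenerators.

(** * The normal form theorem for amalgams *)

(* Here C is one of the two factors, io embeds K in it, and T is the union of
   both factors, with tag and untag the inclusion of C. The pair
   (k, [:: t1; ..; tn]) encodes the product k t1 .. tn with the ti nontrivial
   representatives of right cosets of K; absorbing into C the first factor of
   the list when it lies in C identifies such pairs with elements of
   C x {lists that do not start in C}, on which C acts by left multiplication. *)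
Section FactorAction.
Variables (A C : groupType) (K : set A) (io : A -> C).
Variables (T : Type) (tag : C -> T) (untag : T -> option C).
Hypotheses (subK : is_subgroup K)
  (ioM : forall x y, K x -> K y -> io (x * y) = io x * io y)
  (io_inj : forall x y, K x -> K y -> io x = io y -> x = y)
  (tagK : pcancel tag untag)
  (untagK : forall t c, untag t = Some c -> tag c = t).
Implicit Types (c d : C) (k : A) (l : seq T) (w : A * seq T).

Lemma io1 : io 1 = 1.
Proof. by apply: (mulgI (io 1)); rewrite -ioM ?mulg1 //; exact: subK.1. Qed.

Lemma ioV k : K k -> io k^-1 = (io k)^-1.
Proof.
move=> Kk; apply: (mulgI (io k)).
by rewrite -ioM ?mulgV ?io1 //; exact: is_subgroupV.
Qed.

(** The representative of the right coset of c modulo the image of [K]. It is chosen from a set that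
    depends only on this coset, so it is invariant under left multiplication by [K]; the trivial
    coset gets 1. *)
Definition coset_rep c : C :=
  if `[< (io @` K) c >] then 1 else xget 1 [set d | (io @` K) (c / d)].

Lemma coset_repP c : (io @` K) (c / coset_rep c).
Proof.
rewrite /coset_rep; case: asboolP => [|_]; first by rewrite divg1.
apply: (xgetI (P := [set d | (io @` K) (c / d)]) 1 (x := c)).
by rewrite /= mulgV -io1; exists 1 => //; exact: is_subgroup1.
Qed.

Lemma image_mulK k d : K k -> (io @` K) (io k * d) <-> (io @` K) d.
Proof.
move=> Kk; split=> -[k' Kk' k'E]; last first.
  by exists (k * k'); [exact: is_subgroupM | rewrite ioM // k'E].
have KkV := is_subgroupV subK Kk; exists (k^-1 * k'); first exact: is_subgroupM.
by rewrite ioM // k'E ioV // mulKg.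
Qed.

Lemma coset_rep_mulK k c : K k -> coset_rep (io k * c) = coset_rep c.
Proof.
move=> Kk; rewrite /coset_rep (propext (image_mulK c Kk)); congr (if _ then _ else _).
congr (xget _ _); apply/funext => d.
have dE : (io @` K) (io k * c / d) = (io @` K) (c / d).
  by rewrite -mulgA; exact/propext/image_mulK.
exact: dE.
Qed.

Definition coset_coef c : A := xget 1 [set k | K k /\ io k = c / coset_rep c].

Lemma coset_coefP c : K (coset_coef c) /\ io (coset_coef c) = c / coset_rep c.
Proof.
have [k Kk kE] := coset_repP c.
exact: (xgetI (P := [set k | K k /\ io k = c / coset_rep c]) 1 (x := k)).
Qed.

Lemma coset_decomp c : io (coset_coef c) * coset_rep c = c.
Proof. by rewrite (coset_coefP c).2 mulgVK. Qed.

Lemma coset_rep_id c : coset_rep (coset_rep c) = coset_rep c.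
Proof.
by rewrite -[in RHS](coset_decomp c) coset_rep_mulK //; case: (coset_coefP c).
Qed.

Lemma coset_rep_eq1 c : coset_rep c = 1 <-> (io @` K) c.
Proof.
split=> [c1|]; first by have := coset_repP c; rewrite c1 divg1.
by rewrite /coset_rep; case: asboolP.
Qed.

Lemma coset_coef_mulK k c : K k -> coset_coef (io k * c) = k * coset_coef c.
Proof.
move=> Kk; have [Kc cE] := coset_coefP c.
have [Kkc kcE] := coset_coefP (io k * c).
apply: io_inj => //; first exact: is_subgroupM.
by rewrite ioM // kcE cE coset_rep_mulK // mulgA.
Qed.

Definition free l : bool := if l is t :: _ then ~~ isSome (untag t) else true.

Definition split w : C * seq T :=
  match w.2 with
  | t :: l => if untag t is Some c then (io w.1 * c, l) else (io w.1, w.2)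
  | [::] => (io w.1, [::])
  end.

Definition join c l : A * seq T :=
  (coset_coef c, if `[< (io @` K) c >] then l else tag (coset_rep c) :: l).

Definition act c w : A * seq T := join (c * (split w).1) (split w).2.

(** Reducedness as seen from the factor [C]: an entry of [C] at the head is a nontrivial
    representative and is not followed by another entry of [C]. *)
Definition head_reduced l : Prop :=
  if l is t :: l' then
    forall c, untag t = Some c ->
      [/\ coset_rep c = c, ~ (io @` K) c & free l']
  else True.

Lemma coset_coef_image k : K k -> coset_coef (io k) = k.
Proof.
move=> Kk; have [Kc cE] := coset_coefP (io k); apply: io_inj => //.
by rewrite cE (coset_rep_eq1 (io k)).2 ?divg1 //; exists k.
Qed.

Lemma free_split w : head_reduced w.2 -> free (split w).2.
Proof.
case: w => k [|t l] //=; rewrite /split /=.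
by case E: (untag t) => [c|] /=; rewrite ?E // => /(_ c erefl)[].
Qed.

Lemma join_split w : K w.1 -> head_reduced w.2 -> join (split w).1 (split w).2 = w.
Proof.
case: w => k l /= Kk; have Kio : (io @` K) (io k) by exists k.
have joinK l' : join (io k) l' = (k, l').
  by rewrite /join coset_coef_image // asboolT.
case: l => [|t l] /= hl; rewrite /split /=; first exact: joinK.
case E: (untag t) => [c|] /=; last exact: joinK.
have [cE nc _] := hl c E.
rewrite /join coset_coef_mulK // coset_rep_mulK // cE asboolF; last first.
  by rewrite (propext (image_mulK c Kk)).
(* As c is its own representative, its coefficient is trivial; this is checked after applying the
   injective [io]. *)
rewrite (untagK E); congr (_, _); apply: io_inj => //.
- by apply: is_subgroupM => //; case: (coset_coefP c).
- rewrite ioM //; last by case: (coset_coefP c).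
  by rewrite (coset_coefP c).2 cE mulgV mulg1.
Qed.

Lemma split_join c l : free l -> split (join c l) = (c, l).
Proof.
move=> fl; rewrite /split /join /=; case: asboolP => cK; last first.
  by rewrite tagK coset_decomp.
have ccE : io (coset_coef c) = c.
  by rewrite (coset_coefP c).2 (coset_rep_eq1 c).2 // divg1.
by case: l fl => [|t l] /=; rewrite ?ccE //; case: (untag t).
Qed.

Lemma act1 w : K w.1 -> head_reduced w.2 -> act 1 w = w.
Proof. by move=> Kw hw; rewrite /act mul1g join_split. Qed.

(** [act] is left multiplication on the first component, transported along [split] and [join]; the
    inner [split] undoes the inner [join]. *)
Lemma actM c d w : head_reduced w.2 -> act (c * d) w = act c (act d w).
Proof.
by move=> hw; rewrite /act split_join ?mulgA //; exact: free_split.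
Qed.

(** The formula does not depend on [C], so the actions of the two factors agree on [K] and together
    give an action of the amalgam. *)
Lemma actK k w : K k -> K w.1 -> head_reduced w.2 ->
  act (io k) w = (k * w.1, w.2).
Proof.
move=> Kk Kw hw; rewrite -[in RHS](join_split Kw hw) /act /join.
by rewrite (propext (image_mulK _ Kk)) coset_coef_mulK // coset_rep_mulK.
Qed.

Lemma act_fst c w : K (act c w).1.
Proof. by case: (coset_coefP (c * (split w).1)). Qed.

Lemma act_snd c w : head_reduced w.2 ->
  head_reduced (act c w).2 /\
  ((act c w).2 = (split w).2 \/
   exists d, (act c w).2 = tag d :: (split w).2).
Proof.
move=> hw; rewrite /act /join /=; case: asboolP => dK /=.
  split; last by left.
  case: (split w).2 (free_split hw) => [|t l] //=.
  by case: (untag t).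
split; last by right; eexists.
move=> d; rewrite tagK => -[<-]; split.
- exact: coset_rep_id.
- by move=> /coset_rep_eq1; rewrite coset_rep_id => /coset_rep_eq1.
- exact: free_split.
Qed.

(** Since [c * io w.1] stays outside the image of [K], its coset representative is nontrivial and
    [join] adds it as a new entry. *)
Lemma act_free c w : K w.1 -> free w.2 -> ~ (io @` K) c ->
  exists d, (act c w).2 = tag d :: w.2.
Proof.
move=> Kw fw ncK.
have sE : split w = (io w.1, w.2).
  by case: w fw {Kw} => k [|t l] //=; rewrite /split /=; case: (untag t).
exists (coset_rep (c * io w.1)); rewrite /act /join sE /= asboolF //.
move=> -[k Kk kE]; apply: ncK; exists (k / w.1).
  by apply: is_subgroupM => //; exact: is_subgroupV.
have KV := is_subgroupV subK Kw.
by rewrite ioM // ioV // kE mulgK.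
Qed.

(** Applying [split] to the image of the base point recovers c, so each factor acts faithfully. *)
Lemma act_one_inj c : act c (1, [::]) = (1, [::]) -> c = 1.
Proof.
rewrite /act /split /= io1 mulg1 => cE; have := split_join c (isT : free [::]).
by rewrite cE /split /= io1 => -[<-].
Qed.

End FactorAction.

(** * The action of the amalgam and the normal form theorem *)

Section NormalForm.
Variables (A B : groupType) (K : set A) (xi : A -> B).
Hypotheses (subK : is_subgroup K)
  (xiM : forall x y, K x -> K y -> xi (x * y) = xi x * xi y)
  (xi_inj : forall x y, K x -> K y -> xi x = xi y -> x = y).
Local Notation T := (A + B)%type.
Implicit Types (l S : seq T) (w : A * seq T).

Definition untag_inl (t : T) : option A := if t is inl a then Some a else None.
Definition untag_inr (t : T) : option B := if t is inr b then Some b else None.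

Local Notation redA := (head_reduced K (@id A) untag_inl).
Local Notation redB := (head_reduced K xi untag_inr).
Local Notation actA := (act K (@id A) (@inl A B) untag_inl).
Local Notation actB := (act K xi (@inr A B) untag_inr).

Fixpoint reduced l : Prop :=
  if l is t :: l' then [/\ redA l, redB l & reduced l'] else True.

Definition normal_form w : Prop := K w.1 /\ reduced w.2.

Definition letter_act (s : T * bool) w : A * seq T :=
  match s.1 with
  | inl a => actA (if s.2 then a^-1 else a) w
  | inr b => actB (if s.2 then b^-1 else b) w
  end.

Definition word_act (u : word T) w : A * seq T := foldr letter_act w u.

Let idM x y : K x -> K y -> id (x * y) = id x * id y := fun _ _ => erefl.
Let id_inj x y : K x -> K y -> id x = id y -> x = y := fun _ _ => id.
Let inlK : pcancel (@inl A B) untag_inl. Proof. by []. Qed.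
Let inrK : pcancel (@inr A B) untag_inr. Proof. by []. Qed.
Let untag_inlK (t : T) a : untag_inl t = Some a -> inl a = t.
Proof. by case: t => //= a' [->]. Qed.
Let untag_inrK (t : T) b : untag_inr t = Some b -> inr b = t.
Proof. by case: t => //= b' [->]. Qed.

Lemma reducedA l : reduced l -> redA l. Proof. by case: l => // t l []. Qed.
Lemma reducedB l : reduced l -> redB l. Proof. by case: l => // t l []. Qed.

Lemma reduced_split (C : groupType) (io : A -> C) (untag : T -> option C) w :
  reduced w.2 -> reduced (split io untag w).2.
Proof.
case: w => k [|t l] //= [h1 h2 h3]; rewrite /split /=.
by case: (untag t) => //=; split.
Qed.

Lemma normal_form_actA a w : normal_form w -> normal_form (actA a w).
Proof.
move=> [Kw rw]; split; first exact: (act_fst _ _ subK idM).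
have [h []] := act_snd subK idM inlK a (reducedA rw).
  by move=> ->; exact: reduced_split.
move=> [d dE]; move: h; rewrite dE => h; split => //.
exact: reduced_split.
Qed.

Lemma normal_form_actB b w : normal_form w -> normal_form (actB b w).
Proof.
move=> [Kw rw]; split; first exact: (act_fst _ _ subK xiM).
have [h []] := act_snd subK xiM inrK b (reducedB rw).
  by move=> ->; exact: reduced_split.
move=> [d dE]; move: h; rewrite dE => h; split => //.
exact: reduced_split.
Qed.

Lemma normal_form_word_act u w : normal_form w -> normal_form (word_act u w).
Proof.
move=> nw; elim: u => //= -[[a|b] e] u IH; rewrite /letter_act /=.
  exact: normal_form_actA.
exact: normal_form_actB.
Qed.

Lemma letter_act_cancel t e w : normal_form w ->
  letter_act (t, e) (letter_act (t, ~~ e) w) = w.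
Proof.
move=> [Kw rw]; case: t => c; rewrite /letter_act /=.
  rewrite -(actM subK idM inlK); last exact: reducedA.
  have -> : (if e then c^-1 else c) * (if ~~ e then c^-1 else c) = 1.
    by case: e; rewrite /= ?mulVg ?mulgV.
  by rewrite (act1 subK idM id_inj untag_inlK) //; exact: reducedA.
rewrite -(actM subK xiM inrK); last exact: reducedB.
have -> : (if e then c^-1 else c) * (if ~~ e then c^-1 else c) = 1.
  by case: e; rewrite /= ?mulVg ?mulgV.
by rewrite (act1 subK xiM xi_inj untag_inrK) //; exact: reducedB.
Qed.

Lemma word_act_rel r w : amalgam_rel K xi r -> normal_form w ->
  word_act r w = w.
Proof.
move=> h nw; have [Kw rw] := nw.
have [rA rB] := (reducedA rw, reducedB rw).
case: h => [x y|x y|k Kk]; rewrite /word_act /letter_act /=.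
- have nw' := normal_form_actA (x * y)^-1 nw.
  rewrite -!(actM subK idM inlK) //; last exact: (reducedA nw'.2).
  by rewrite mulgV (act1 subK idM id_inj untag_inlK).
- have nw' := normal_form_actB (x * y)^-1 nw.
  rewrite -!(actM subK xiM inrK) //; last exact: (reducedB nw'.2).
  by rewrite mulgV (act1 subK xiM xi_inj untag_inrK).
(* Both [xi k] and k only multiply the coefficient, by [actK] in the respective factor, so the two
   letters cancel. *)
- have KkV := is_subgroupV subK Kk.
  rewrite -(ioV subK xiM) // (actK subK xiM xi_inj untag_inrK) //.
  rewrite -[k in actA k]/(id k) (actK subK idM id_inj untag_inlK) //=.
    by case: w {nw Kw rw rA rB} => ? ? /=; rewrite mulVKg.
  exact: is_subgroupM.
Qed.

Lemma pres_eq_word_act u v w : pres_eq (amalgam_rel K xi) u v ->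
  normal_form w -> word_act u w = word_act v w.
Proof.
move=> h; elim: h w => {u v}.
- by [].
- by move=> u v _ IH w nw; rewrite IH.
- by move=> u v x _ IH1 _ IH2 w nw; rewrite IH1 // IH2.
- move=> u u' v v' _ IH1 _ IH2 w nw.
  rewrite /word_act !foldr_cat -!/(word_act _ _) IH2 // IH1 //.
  exact: normal_form_word_act.
- by move=> t e w nw; exact: letter_act_cancel.
- by move=> r rR w nw; exact: word_act_rel.
Qed.

Definition is_left (t : T) : bool := if t is inl _ then true else false.

Definition in_amalgamated (t : T) : Prop :=
  match t with inl a => K a | inr b => (xi @` K) b end.

Definition alternating S : bool := sorted (fun s t => is_left s != is_left t) S.

Definition amalgam_prod S : amalgam K xi :=
  \prod_(s <- S) pres_gen (amalgam_rel K xi) s.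

Lemma amalgam_prodE S :
  amalgam_prod S = pres_class (amalgam_rel K xi) [seq (s, false) | s <- S].
Proof.
rewrite /amalgam_prod; elim: S => [|s S IH]; first by rewrite big_nil.
by rewrite big_cons IH [LHS]pres_mulE.
Qed.

Lemma base_normal_form : normal_form (1, [::]).
Proof. by split => //; exact: is_subgroup1. Qed.

Lemma amalgam_prod_eq1 S : amalgam_prod S = 1 ->
  word_act [seq (s, false) | s <- S] (1, [::]) = (1, [::]).
Proof.
rewrite amalgam_prodE => /pres_classP h.
exact: (pres_eq_word_act h base_normal_form).
Qed.

(** Acting on the base point from the right end of [S], each factor prepends one entry of its own
    side. The sides of the resulting list are therefore those of [S], while a trivial product leaves
    the list empty. *)
Lemma normal_form_theorem S : alternating S ->
  (forall S1 s S2, S = S1 ++ s :: S2 -> ~ in_amalgamated s) ->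
  amalgam_prod S = 1 -> S = [::].
Proof.
move=> altS nS /amalgam_prod_eq1 actS.
suff : [seq is_left t | t <- (word_act [seq (s, false) | s <- S] (1, [::])).2]
  = [seq is_left t | t <- S] by rewrite actS; case: (S).
elim: S altS nS {actS} => //= s S IH altS nS.
have {}IH := IH (path_sorted altS) _.
have /IH {}IH : forall S1 t S2, S = S1 ++ t :: S2 -> ~ in_amalgamated t.
  by move=> S1 t S2 SE; apply: (nS (s :: S1) t S2); rewrite SE.
have ns : ~ in_amalgamated s by apply: (nS [::] s S).
have [] := normal_form_word_act [seq (s, false) | s <- S] base_normal_form.
rewrite -!/(word_act _ _).
case: (word_act _ _) IH => k l /= IH Kk rl.
(* The head of [l] has the side of the letter following s, which is opposite to that of s by
   alternation; this makes [l] free for the factor of s. *)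
have hs : if l is t :: _ then is_left t = ~~ is_left s else true.
  case: l IH {rl} => // t l; case: S altS {nS} => //= s' S /andP[ss' _] [-> _].
  by move: ss'; case: (is_left s); case: (is_left s').
rewrite /letter_act; case: s {altS nS} ns hs => [a|b] /= ns hs.
  have [] := act_free (@inl A B) (untag := untag_inl) subK idM (c := a) (w := (k, l)) Kk.
  - by case: l hs {IH rl} => //= -[].
  - by rewrite image_id.
  - by move=> d /= ->; rewrite /= IH.
have [] := act_free (@inr A B) (untag := untag_inr) subK xiM (c := b) (w := (k, l)) Kk.
- by case: l hs {IH rl} => //= -[].
- by [].
- by move=> d /= ->; rewrite /= IH.
Qed.

Lemma amalgam_inl_eq1 a : amalgam_inl K xi a = 1 -> a = 1.
Proof.
move=> a1; have := @amalgam_prod_eq1 [:: inl a].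
rewrite /amalgam_prod big_seq1 => /(_ a1).
exact: (act_one_inj subK idM inlK).
Qed.

Lemma amalgam_inr_eq1 b : amalgam_inr K xi b = 1 -> b = 1.
Proof.
move=> b1; have := @amalgam_prod_eq1 [:: inr b].
rewrite /amalgam_prod big_seq1 => /(_ b1).
exact: (act_one_inj subK xiM inrK).
Qed.

End NormalForm.

(** * Reduction of words cut into syllables *)

Section Syllables.
Variables (A B : groupType) (M N : Type)
  (A_ : M -> set A) (K : set A) (B_ : N -> set B).
Hypotheses (subA : forall mu, is_subgroup (A_ mu)) (subK : is_subgroup K)
  (subB : forall nu, is_subgroup (B_ nu)).
Variables (X1 : set A) (R1 : set (rel_free (add_subgroup A_ K) X1))
  (X2 : set B) (R2 : set (rel_free B_ X2)).
Variables (gamma1 gamma2 gamma : nat -> nat).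
Hypotheses (isoA : rel_isoperimetric R1 gamma1)
  (isoB : rel_isoperimetric R2 gamma2)
  (gamma1_le : forall n, (gamma1 n <= gamma n)%N)
  (gamma2_le : forall n, (gamma2 n <= gamma n)%N).
Variables (eta : N) (xi : A -> B).
Hypotheses (xiM : forall x y, K x -> K y -> xi (x * y) = xi x * xi y)
  (xi_inj : forall x y, K x -> K y -> xi x = xi y -> x = y)
  (xi_eta : forall x, K x -> B_ eta (xi x)).
Variables (F : groupType) (R : set F) (a : nat).
Variables (phi1 : rel_free (add_subgroup A_ K) X1 -> F)
  (phi2 : rel_free B_ X2 -> F).
Hypotheses (phi1M : {morph phi1 : x y / x * y})
  (phi2M : {morph phi2 : x y / x * y})
  (phiK : forall k (Kk : K k),
     phi1 (@factor_gen _ _ (add_subgroup A_ K) X1 None k Kk) =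
     phi2 (factor_gen X2 (xi_eta Kk)))
  (phi1R : forall r, R1 r -> area_le R a (phi1 r))
  (phi2R : forall r, R2 r -> area_le R a (phi2 r)).

Local Notation gbar := (superadditive_closure gamma).
Local Notation LA := (rel_letter (add_subgroup A_ K) X1).
Local Notation LB := (rel_letter B_ X2).
Local Notation syllable := (seq LA + seq LB)%type.
Implicit Types (s t : syllable) (S : seq syllable).

Lemma is_subgroup_add l : is_subgroup (add_subgroup A_ K l).
Proof. by case: l. Qed.

Definition syllable_size s : nat :=
  match s with inl U => size U | inr V => size V end.

Definition syllable_image s : F :=
  match s with
  | inl U => phi1 (rel_word_free U)
  | inr V => phi2 (rel_word_free V)
  end.

Definition syllable_val s : A + B :=
  match s with
  | inl U => inl (rel_free_hom (rel_word_free U))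
  | inr V => inr (rel_free_hom (rel_word_free V))
  end.

Definition syllables_size S : nat := (\sum_(s <- S) syllable_size s)%N.
Definition syllables_image S : F := \prod_(s <- S) syllable_image s.
Definition syllables_val S : amalgam K xi :=
  amalgam_prod K xi [seq syllable_val s | s <- S].

Lemma syllables_val_cat S1 S2 :
  syllables_val (S1 ++ S2) = syllables_val S1 * syllables_val S2.
Proof. by rewrite /syllables_val /amalgam_prod map_cat big_cat. Qed.

Lemma syllables_val1 s :
  syllables_val [:: s] = pres_gen (amalgam_rel K xi) (syllable_val s).
Proof. by rewrite /syllables_val /amalgam_prod big_seq1. Qed.

Lemma syllable_merge s t :
  is_left (syllable_val s) = is_left (syllable_val t) ->
  exists u, [/\ syllable_size u = (syllable_size s + syllable_size t)%N,
    syllable_image u = syllable_image s * syllable_image t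
    & syllables_val [:: u] = syllables_val [:: s; t]].
Proof.
rewrite -cat1s syllables_val_cat.
case: s t => [U|U] [V|V] //= _; [exists (inl (U ++ V)) | exists (inr (U ++ V))].
  rewrite /= size_cat rel_word_free_cat phi1M; split => //.
  by rewrite !syllables_val1 /= rel_word_free_cat rel_free_homM; exact: amalgam_inlM.
rewrite /= size_cat rel_word_free_cat phi2M; split => //.
by rewrite !syllables_val1 /= rel_word_free_cat rel_free_homM; exact: amalgam_inrM.
Qed.

(** The factors embed in the amalgam, so the syllable is already trivial in its own factor and the
    isoperimetric function of that factor applies. Positivity of n serves the comparison of [gamma]
    with [gbar]. *)
Lemma syllable_area s n : (syllable_size s <= n)%N -> (0 < n)%N ->
  syllables_val [:: s] = 1 -> area_le R (a * gbar n) (syllable_image s).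
Proof.
move=> sn n0 s1; apply: (@area_leW _ _ (a * gamma n)).
  by rewrite leq_mul2l superadditive_closure_id ?orbT.
case: s sn s1 => W /= Wn; rewrite syllables_val1 => W1.
  apply: (@area_leW _ _ (a * gamma1 n)); first by rewrite leq_mul2l gamma1_le orbT.
  apply: (area_le_morph phi1M phi1R); apply: rel_isoperimetric_area_le => //.
  exact: (amalgam_inl_eq1 subK xiM xi_inj).
apply: (@area_leW _ _ (a * gamma2 n)); first by rewrite leq_mul2l gamma2_le orbT.
apply: (area_le_morph phi2M phi2R); apply: rel_isoperimetric_area_le => //.
exact: (amalgam_inr_eq1 subK xiM xi_inj).
Qed.

Lemma syllable_swap s : in_amalgamated K xi (syllable_val s) ->
  exists t, [/\ is_left (syllable_val t) = ~~ is_left (syllable_val s),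
    (syllable_size t <= 1)%N,
    syllables_val [:: t] = syllables_val [:: s]
    & area_le R (a * gbar (syllable_size s).+1)
        (syllable_image s / syllable_image t)].
Proof.
rewrite !syllables_val1.
case: s => [U|V] /=.
  set k := rel_free_hom _ => Kk.
  have [w w1 wE] := factor_gen_word X2 (xi_eta Kk).
  have KkV := is_subgroupV subK Kk.
  (* [w'] spells the inverse of k on the side of [U]. Hence [U ++ w'] is a trivial syllable of
     length at most [(size U).+1], and by [phiK] its image is the quotient to be bounded. *)
  have [w' w'1 w'E] := @factor_gen_word _ _ (add_subgroup A_ K) X1 None _ KkV.
  have w'E' : phi1 (rel_word_free w') = (phi2 (rel_word_free w))^-1.
    rewrite w'E wE -phiK -(morphV phi1M); congr phi1.
    exact: (@factor_genV _ _ (add_subgroup A_ K) X1 is_subgroup_add None k).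
  exists (inr w); split => //.
    by rewrite syllables_val1 /= wE rel_free_hom_factor_gen; exact/esym/amalgam_inlE.
  rewrite /= -w'E' -phi1M -rel_word_free_cat.
  apply: (@syllable_area (inl (U ++ w'))) => //=.
    by rewrite size_cat -addn1 leq_add2l.
  rewrite syllables_val1 /= rel_word_free_cat rel_free_homM w'E.
  by rewrite rel_free_hom_factor_gen mulgV; exact: (morph1 (amalgam_inlM K xi)).
move=> [k Kk kE].
have [w w1 wE] := @factor_gen_word _ _ (add_subgroup A_ K) X1 None _ Kk.
(* The mirror case: [w] spells k in [A], and [w'] spells the inverse of [xi k] in [B_ eta]. *)
have xiV := ioV subK xiM Kk; have KkV := xi_eta (is_subgroupV subK Kk).
have [w' w'1 w'E] := factor_gen_word X2 KkV.
have w'E' : phi2 (rel_word_free w') = (phi1 (rel_word_free w))^-1.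
  rewrite w'E wE phiK -(morphV phi2M); congr phi2.
  have xiKV : B_ eta (xi k)^-1 by rewrite -xiV.
  by rewrite (eq_factor_gen _ KkV xiKV xiV) (factor_genV _ subB (xi_eta Kk)).
exists (inl w); split => //.
  rewrite syllables_val1 /= wE rel_free_hom_factor_gen -kE.
  exact: amalgam_inlE.
rewrite /= -w'E' -phi2M -rel_word_free_cat.
apply: (@syllable_area (inr (V ++ w'))) => //=.
  by rewrite size_cat -addn1 leq_add2l.
rewrite syllables_val1 /= rel_word_free_cat rel_free_homM w'E.
by rewrite rel_free_hom_factor_gen -kE xiV mulgV; exact: (morph1 (amalgam_inrM K xi)).
Qed.

Local Notation alternate :=
  (sorted (fun s t => is_left (syllable_val s) != is_left (syllable_val t))).

Lemma not_alternate_split S : ~~ alternate S -> exists S1 s t S2,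
  S = S1 ++ [:: s, t & S2] /\
  is_left (syllable_val s) = is_left (syllable_val t).
Proof.
elim: S => // s [|t S] IH //=; rewrite negb_and negbK => /orP[/eqP st|].
  by exists [::], s, t, S.
by move=> /IH[S1 [s' [t' [S2 [-> stE]]]]]; exists (s :: S1), s', t', S2.
Qed.

Lemma alternate_swap S1 s t S2 : (1 < size (S1 ++ s :: S2))%N ->
  is_left (syllable_val t) = ~~ is_left (syllable_val s) ->
  alternate (S1 ++ s :: S2) -> ~~ alternate (S1 ++ t :: S2).
Proof.
(* Changing the side of s creates two equal neighbouring sides: with the successor of s if there is
   one, otherwise with its predecessor, which exists by the size assumption. *)
move=> sz ts; case: S2 sz => [|u S2] sz.
  case/lastP: S1 sz => // S1 u _; rewrite -!cats1 -!catA /= => /cat_sorted2[_ /=].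
  move=> us; apply/negP => /cat_sorted2[_ /=]; move: us; rewrite ts.
  by case: (is_left (syllable_val u)); case: (is_left (syllable_val s)).
move=> /cat_sorted2[_ /= /andP[su _]]; apply/negP => /cat_sorted2[_ /= /andP[]].
move: su; rewrite ts.
by case: (is_left (syllable_val u)); case: (is_left (syllable_val s)).
Qed.

(** The contrapositive of the normal form theorem, pulled back from values to syllables. *)
Lemma alternate_amalgamated S : alternate S -> S <> [::] ->
  syllables_val S = 1 -> exists S1 s S2,
    S = S1 ++ s :: S2 /\ in_amalgamated K xi (syllable_val s).
Proof.
move=> altS S0 S1; apply/not_existsP => nS; apply: S0.
suff : [seq syllable_val s | s <- S] = [::] by case: (S).
apply: (normal_form_theorem subK xiM) => //.
  by rewrite /alternating sorted_map.
move=> T1 t T2 ST tK.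
have [S' [s [S'' [SE sE]]]] : exists S' s S'',
    S = S' ++ s :: S'' /\ syllable_val s = t.
  elim: (S) T1 ST => [|s S' IH] [|t1 T1] //= [st ST].
    by exists [::], s, S'.
  have [S'' [s' [S''' [-> ?]]]] := IH T1 ST.
  by exists (s :: S''), s', S'''.
by apply: (nS S'); exists s, S''; rewrite sE.
Qed.

(** Induction on the number of syllables. A swap preserves this number, so it is paired with the
    merge that it makes possible; this is why merging is proved first, for every non-alternating
    list within the size bound. *)
Lemma syllables_image_area S : syllables_val S = 1 ->
  area_le R (a * gbar (syllables_size S + 2 * size S)) (syllables_image S).
Proof.
have [m Sm] := ubnP (size S); elim: m S Sm => // m IH S Sm S1.
(* Merging two neighbouring syllables of the same side lowers the potential
   [syllables_size S + 2 * size S] by 2. *)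
have merge T : (size T < m.+1)%N -> ~~ alternate T -> syllables_val T = 1 ->
    area_le R (a * gbar (syllables_size T + 2 * (size T).-1))
      (syllables_image T).
  move=> Tm /not_alternate_split[T1 [s [t [T2 [TE st]]]]] T0.
  have [u [u_size u_image u_val]] := syllable_merge st.
  have : syllables_val (T1 ++ u :: T2) = 1.
    by rewrite -T0 TE -cat1s -[s :: _]/([:: s; t] ++ T2) !syllables_val_cat u_val.
  move=> /IH; rewrite -ltnS; have -> : size (T1 ++ u :: T2) = (size T).-1.
    by rewrite TE !size_cat /= !addnS.
  have -> : syllables_size (T1 ++ u :: T2) = syllables_size T.
    by rewrite TE /syllables_size !big_cat /= !big_cons u_size -!addnA.
  have -> : syllables_image (T1 ++ u :: T2) = syllables_image T.
    by rewrite TE /syllables_image !big_cat /= !big_cons u_image -!mulgA.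
  by apply; move: Tm; rewrite TE size_cat /= addnS.
case: (boolP (alternate S)) => [altS|naltS]; last first.
  apply: area_leW (merge S Sm naltS S1).
  rewrite leq_mul2l leq_superadditive_closure ?orbT // leq_add2l leq_mul2l.
  by rewrite leq_pred.
(* A lone syllable has no neighbour to merge with after a swap, but it is trivial and
   [syllable_area] settles it. *)
case: (ltnP 1 (size S)) => [S2|]; last first.
  case: S Sm S1 altS => [|s []] // _ s1 _ _.
    by rewrite /syllables_image big_nil; exact: area_le0.
  rewrite /syllables_image big_seq1; apply: syllable_area => //.
    by rewrite /syllables_size big_seq1 leq_addr.
  by rewrite addn_gt0 orbT.
have [T1 [s [T2 [SE sK]]]] : exists S1 s S2,
    S = S1 ++ s :: S2 /\ in_amalgamated K xi (syllable_val s).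
  by apply: alternate_amalgamated => // S0; move: S2; rewrite S0.
have [t [ts t_size t_val t_area]] := syllable_swap sK.
have size_t : size (T1 ++ t :: T2) = size S by rewrite SE !size_cat.
have naltT : ~~ alternate (T1 ++ t :: T2).
  by rewrite SE in S2 altS; exact: alternate_swap S2 ts altS.
have T1E : syllables_val (T1 ++ t :: T2) = 1.
  by rewrite -S1 SE -cat1s -[s :: T2]cat1s !syllables_val_cat t_val.
have := merge (T1 ++ t :: T2); rewrite size_t => /(_ Sm naltT T1E) area_t.
have swap_area : area_le R (a * gbar (syllable_size s).+1)
    (syllables_image S / syllables_image (T1 ++ t :: T2)).
  rewrite SE /syllables_image !big_cat /= !big_cons !mulgA.
  exact: area_le_div.
have := area_leM swap_area area_t; rewrite mulgVK; apply: area_leW.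
rewrite -mulnDr leq_mul2l; apply/orP; right.
(* With l the size of s, n the total length and p the number of syllables, the arguments add up to
   at most (l + 1) + (n - l + 1) + 2 (p - 1) = n + 2 p. *)
apply: leq_trans (superadditive_closureD _ _ _) _.
apply: leq_superadditive_closure.
rewrite SE /syllables_size !big_cat /= !big_cons.
have -> : size (T1 ++ s :: T2) = (size T1 + size T2).+1 by rewrite size_cat addnS.
rewrite -pred_Sn mulnS [leqLHS]addnA [leqRHS]addnA leq_add2r.
rewrite addnCA -[leqRHS]addnA leq_add2l addnA [leqRHS]addnAC leq_add2r.
by rewrite addSnnS leq_add2l.
Qed.

Definition letter_val (l : LA + LB) : A + B :=
  match l with
  | inl x => inl (rel_free_hom (rel_letter_free x))
  | inr y => inr (rel_free_hom (rel_letter_free y))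
  end.

Definition letter_image (l : LA + LB) : F :=
  match l with
  | inl x => phi1 (rel_letter_free x)
  | inr y => phi2 (rel_letter_free y)
  end.

Definition letters_val (W : seq (LA + LB)) : amalgam K xi :=
  amalgam_prod K xi [seq letter_val l | l <- W].

Definition letters_image (W : seq (LA + LB)) : F := \prod_(l <- W) letter_image l.

(** Each letter is taken as a syllable of size 1; the potential is then [size W + 2 * size W],
    whence the factor 3. *)
Lemma letters_image_area W : letters_val W = 1 ->
  area_le R (a * gbar (3 * size W)) (letters_image W).
Proof.
pose syl (l : LA + LB) : syllable :=
  match l with inl x => inl [:: x] | inr y => inr [:: y] end.
move=> W1; have := @syllables_image_area (map syl W).
rewrite /syllables_val /syllables_image /syllables_size -map_comp !big_map size_map.
have -> : (\sum_(l <- W) syllable_size (syl l) = size W)%N.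
  by rewrite -sum1_size; apply: eq_bigr => -[].
rewrite -mulSn => area_W.
have -> : letters_image W = \prod_(l <- W) syllable_image (syl l).
  by apply: eq_bigr => -[l|l] _ /=; rewrite /rel_word_free big_seq1.
apply: area_W; rewrite -[RHS]W1; congr amalgam_prod; apply: eq_map => -[l|l] /=.
  by rewrite /rel_word_free big_seq1.
by rewrite /rel_word_free big_seq1.
Qed.

End Syllables.

(** * Relative presentations of the amalgam *)

Lemma is_subgroup_image (C D : groupType) (f : C -> D) (S : set C) :
  {morph f : x y / x * y} -> is_subgroup S -> is_subgroup (f @` S).
Proof.
move=> fM [S1 SM]; split; first by exists 1 => //; exact: morph1.
by move=> _ _ [x Sx <-] [y Sy <-]; exists (x / y);
  [exact: SM | rewrite fM morphV].
Qed.

Section Amalgam.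
Variables (A B : groupType) (M N : Type)
  (A_ : M -> set A) (K : set A) (B_ : N -> set B).
Hypotheses (subA : forall mu, is_subgroup (A_ mu)) (subK : is_subgroup K)
  (subB : forall nu, is_subgroup (B_ nu)).
Variables (X1 : set A) (R1 : set (rel_free (add_subgroup A_ K) X1))
  (X2 : set B) (R2 : set (rel_free B_ X2)).
Hypotheses (presA : finite_rel_presentation R1)
  (presB : finite_rel_presentation R2).
Variables (gamma1 gamma2 : nat -> nat).
Hypotheses (isoA : rel_isoperimetric R1 gamma1)
  (isoB : rel_isoperimetric R2 gamma2).
Variables (eta : N) (xi : A -> B).
Hypotheses (xiM : forall x y, K x -> K y -> xi (x * y) = xi x * xi y)
  (xi_inj : forall x y, K x -> K y -> xi x = xi y -> x = y)
  (xi_eta : forall x, K x -> B_ eta (xi x)).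

Local Notation gamma := (fun n => maxn (gamma1 n) (gamma2 n)).
Local Notation gbar := (superadditive_closure gamma).
Local Notation G := (amalgam K xi).
Local Notation H := (union_family (fun mu => amalgam_inl K xi @` A_ mu)
                        (fun nu => amalgam_inr K xi @` B_ nu)).
Local Notation FA := (rel_free (add_subgroup A_ K) X1).
Local Notation FB := (rel_free B_ X2).
Local Notation LA := (rel_letter (add_subgroup A_ K) X1).
Local Notation LB := (rel_letter B_ X2).
Local Notation inA := (amalgam_inl K xi).
Local Notation inB := (amalgam_inr K xi).

Let subAK l : is_subgroup (add_subgroup A_ K l).
Proof. by case: l. Qed.

Lemma is_subgroup_union_family i : is_subgroup (H i).
Proof.
case: i => [mu|nu] /=; apply: is_subgroup_image => //.
  exact: amalgam_inlM.
exact: amalgam_inrM.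
Qed.

Lemma letters_val_surj (g : G) :
  exists W : seq (LA + LB), letters_val xi W = g.
Proof.
have [[symA genA _] _ _] := presA; have [[symB genB _] _ _] := presB.
pose S := [set g : G | exists W : seq (LA + LB), letters_val xi W = g].
have SM x y : S x -> S y -> S (x * y).
  move=> [U <-] [V <-]; exists (U ++ V).
  by rewrite /letters_val /amalgam_prod map_cat big_cat.
have Sa a : S (inA a).
  have [U <-] := rel_word_surj subAK symA genA a.
  exists [seq inl x | x <- U]; rewrite /letters_val /amalgam_prod !big_map.
  rewrite /rel_word_free (morph_prod (@rel_free_homM _ _ _ _)).
  by rewrite (morph_prod (amalgam_inlM K xi)).
have Sb b : S (inB b).
  have [U <-] := rel_word_surj subB symB genB b.
  exists [seq inr x | x <- U]; rewrite /letters_val /amalgam_prod !big_map.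
  rewrite /rel_word_free (morph_prod (@rel_free_homM _ _ _ _)).
  by rewrite (morph_prod (amalgam_inrM K xi)).
apply: (@pres_group_ind _ _ S) => [|[a|b] x Sx|[a|b] x Sx].
- by exists [::]; rewrite /letters_val /amalgam_prod big_nil.
- by apply: SM => //; exact: Sa.
- by apply: SM => //; exact: Sb.
- apply: SM => //; rewrite -[pres_gen _ _]/(inA a).
  by rewrite -(morphV (amalgam_inlM K xi)).
- apply: SM => //; rewrite -[pres_gen _ _]/(inB b).
  by rewrite -(morphV (amalgam_inrM K xi)).
Qed.

(** * Lifting both relative free groups to that of the amalgam *)

Section Lift.
Variables (X : set G) (lift1 : X1 -> rel_free H X) (lift2 : X2 -> rel_free H X).
Hypotheses (lift1K : forall x, rel_free_hom (lift1 x) = inA (val x))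
  (lift2K : forall x, rel_free_hom (lift2 x) = inB (val x)).

Definition inA_gen mu x (Ax : A_ mu x) : rel_free H X :=
  @factor_gen G (M + N) H X (inl mu) (inA x) (ex_intro2 _ _ x Ax erefl).

Definition inB_gen nu y (By : B_ nu y) : rel_free H X :=
  @factor_gen G (M + N) H X (inr nu) (inB y) (ex_intro2 _ _ y By erefl).

(** [K] is not in the family of the amalgam, so its letters are sent through [xi] to the factor of
    [B_ eta]. *)
Definition lift_A_factor (l : option M) :
    forall x, add_subgroup A_ K l x -> rel_free H X :=
  match l with
  | Some mu => fun x Ax => inA_gen Ax
  | None => fun x Kx => inB_gen (xi_eta Kx)
  end.

Lemma lift_A_factorM l g h k (Hg : add_subgroup A_ K l g)
    (Hh : add_subgroup A_ K l h) (Hk : add_subgroup A_ K l k) :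
  g * h = k -> lift_A_factor Hg * lift_A_factor Hh = lift_A_factor Hk.
Proof.
case: l Hg Hh Hk => [mu|] Hg Hh Hk ghk; apply: factor_genM.
  by rewrite -amalgam_inlM ghk.
by rewrite -amalgam_inrM -ghk xiM.
Qed.

Lemma inB_genM nu g h k (Hg : B_ nu g) (Hh : B_ nu h) (Hk : B_ nu k) :
  g * h = k -> inB_gen Hg * inB_gen Hh = inB_gen Hk.
Proof. by move=> ghk; apply: factor_genM; rewrite -amalgam_inrM ghk. Qed.

Definition lift_A : FA -> rel_free H X := rel_free_lift lift1 lift_A_factor.
Definition lift_B : FB -> rel_free H X := rel_free_lift lift2 inB_gen.

Lemma lift_AM : {morph lift_A : x y / x * y}.
Proof. by apply: rel_free_liftM => *; exact: lift_A_factorM. Qed.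

Lemma lift_BM : {morph lift_B : x y / x * y}.
Proof. by apply: rel_free_liftM => *; exact: inB_genM. Qed.

Lemma lift_A_basis x : lift_A (basis_gen _ x) = lift1 x.
Proof. by apply: rel_free_lift_basis => *; exact: lift_A_factorM. Qed.

Lemma lift_B_basis x : lift_B (basis_gen _ x) = lift2 x.
Proof. by apply: rel_free_lift_basis => *; exact: inB_genM. Qed.

Lemma lift_A_factor_gen l x (Hx : add_subgroup A_ K l x) :
  lift_A (factor_gen X1 Hx) = lift_A_factor Hx.
Proof. by apply: rel_free_lift_factor => *; exact: lift_A_factorM. Qed.

Lemma lift_B_factor_gen nu y (By : B_ nu y) : lift_B (factor_gen X2 By) = inB_gen By.
Proof. by apply: rel_free_lift_factor => *; exact: inB_genM. Qed.

Lemma rel_free_hom_lift_A u : rel_free_hom (lift_A u) = inA (rel_free_hom u).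
Proof.
have homM := @rel_free_homM _ _ H X.
have homAM := @rel_free_homM _ _ (add_subgroup A_ K) X1.
have inAM := amalgam_inlM K xi.
elim/(rel_free_ind (X := X1) subAK): u => [|x u IH|x u IH|l g Hg u IH].
- by rewrite (morph1 lift_AM) !(morph1 homM) (morph1 homAM) (morph1 inAM).
- by rewrite lift_AM homM homAM inAM IH lift_A_basis lift1K rel_free_hom_basis_gen.
- rewrite lift_AM homM homAM inAM IH (morphV lift_AM) (morphV homM) (morphV homAM).
  by rewrite (morphV inAM) lift_A_basis lift1K rel_free_hom_basis_gen.
- rewrite lift_AM homM homAM inAM IH lift_A_factor_gen rel_free_hom_factor_gen.
  case: l Hg => [mu|] Hg /=; rewrite rel_free_hom_factor_gen //.
  by rewrite (amalgam_inlE xi Hg).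
Qed.

Lemma rel_free_hom_lift_B v : rel_free_hom (lift_B v) = inB (rel_free_hom v).
Proof.
have homM := @rel_free_homM _ _ H X.
have homBM := @rel_free_homM _ _ B_ X2.
have inBM := amalgam_inrM K xi.
elim/(rel_free_ind (X := X2) subB): v => [|x u IH|x u IH|l g Hg u IH].
- by rewrite (morph1 lift_BM) !(morph1 homM) (morph1 homBM) (morph1 inBM).
- by rewrite lift_BM homM homBM inBM IH lift_B_basis lift2K rel_free_hom_basis_gen.
- rewrite lift_BM homM homBM inBM IH (morphV lift_BM) (morphV homM) (morphV homBM).
  by rewrite (morphV inBM) lift_B_basis lift2K rel_free_hom_basis_gen.
- by rewrite lift_BM homM homBM inBM IH lift_B_factor_gen !rel_free_hom_factor_gen.
Qed.

Local Notation img := (letters_image lift_A lift_B).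

Lemma rel_free_hom_letters W : rel_free_hom (img W) = letters_val xi W.
Proof.
rewrite /letters_image (morph_prod (@rel_free_homM _ _ _ _)).
rewrite /letters_val /amalgam_prod big_map; apply: eq_bigr => -[l|l] _ /=.
  exact: rel_free_hom_lift_A.
exact: rel_free_hom_lift_B.
Qed.

(** Every factor of the amalgam is the image of some [A_ mu] or [B_ nu], so its letters are lifted
    letters on the nose, at no cost in area. *)
Lemma factor_gen_letters i g (Hg : H i g) :
  exists2 W, (size W <= 1)%N & factor_gen X Hg = img W.
Proof.
case: i Hg => [mu|nu] /= [x Hx xg].
  have [w w1 wE] := @factor_gen_word _ _ (add_subgroup A_ K) X1 (Some mu) _ Hx.
  exists [seq inl l | l <- w]; first by rewrite size_map.
  rewrite /letters_image big_map -(morph_prod lift_AM) -/(rel_word_free _) wE.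
  by rewrite lift_A_factor_gen; apply: eq_factor_gen.
have [w w1 wE] := factor_gen_word X2 Hx.
exists [seq inr l | l <- w]; first by rewrite size_map.
rewrite /letters_image big_map -(morph_prod lift_BM) -/(rel_word_free _) wE.
by rewrite lift_B_factor_gen; apply: eq_factor_gen.
Qed.

Lemma lifted_letters_image_area (R : set (rel_free H X)) a W :
  (forall r, R1 r -> area_le R a (lift_A r)) ->
  (forall r, R2 r -> area_le R a (lift_B r)) ->
  letters_val xi W = 1 -> area_le R (a * gbar (3 * size W)) (img W).
Proof.
move=> R1a R2a.
apply: (letters_image_area subA subK subB isoA isoB _ _
  xiM xi_inj (xi_eta := xi_eta)) => //.
- by move=> n; exact: leq_maxl.
- by move=> n; exact: leq_maxr.
- exact: lift_AM.
- exact: lift_BM.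
- by move=> k Kk; rewrite (@lift_A_factor_gen None) lift_B_factor_gen.
Qed.

End Lift.

(** The generators are the images of [X1] and [X2], and the relators are the lifts of [R1] and [R2],
    so each lifted relator has area at most 1. *)
Lemma amalgam_finitely_presented_rel : finitely_presented_rel H.
Proof.
pose X := inA @` X1 `|` inB @` X2.
have XA (x : X1) : X (inA (val x)) by left; exists (val x) => //; exact: set_mem (valP x).
have XB (x : X2) : X (inB (val x)) by right; exists (val x) => //; exact: set_mem (valP x).
pose lift1 (x : X1) : rel_free H X := basis_gen H (SigSub (mem_set (XA x))).
pose lift2 (x : X2) : rel_free H X := basis_gen H (SigSub (mem_set (XB x))).
have lift1K x : rel_free_hom (lift1 x) = inA (val x) by rewrite rel_free_hom_basis_gen.
have lift2K x : rel_free_hom (lift2 x) = inB (val x) by rewrite rel_free_hom_basis_gen.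
have [pA finX1 finR1] := presA; have [pB finX2 finR2] := presB.
have [symA genA _] := pA; have [symB genB _] := pB.
have subG := is_subgroup_union_family.
pose R := lift_A lift1 @` R1 `|` lift_B lift2 @` R2.
have homM := @rel_free_homM _ _ H X.
have Rker r : R r -> rel_free_hom r = 1.
  move=> [] [s Rs <-].
    rewrite (rel_free_hom_lift_A lift1K) (rel_presentation_rel1 pA Rs).
    exact: morph1 (amalgam_inlM K xi).
  rewrite (rel_free_hom_lift_B lift2K) (rel_presentation_rel1 pB Rs).
  exact: morph1 (amalgam_inrM K xi).
have R1R r : R1 r -> area_le R 1 (lift_A lift1 r).
  by move=> Rr; apply: area_le_rel; left; exists r.
have R2R r : R2 r -> area_le R 1 (lift_B lift2 r).
  by move=> Rr; apply: area_le_rel; right; exists r.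
exists X, R; split; last 2 first.
- by rewrite finite_setU; split; exact: finite_image.
- by rewrite finite_setU; split; exact: finite_image.
split.
- move=> _ [] [x Xx <-]; [left|right]; exists x^-1; [exact: symA| |exact: symB|].
    by rewrite (morphV (amalgam_inlM K xi)).
  by rewrite (morphV (amalgam_inrM K xi)).
- apply/seteqP; split => // g _ S [[S1 Sd] SXH].
  have SV x : S x -> S x^-1 by move=> Sx; rewrite -(mul1g x^-1); exact: Sd.
  have SM x y : S x -> S y -> S (x * y).
    by move=> Sx Sy; rewrite -[y]invgK; apply: Sd => //; exact: SV.
  (* [B] comes before [A], because an element of [K] is reached through its image under [xi] in
     [B]. *)
  have SB b : S (inB b).
    have : gen_subgroup (X2 `|` \bigcup_l B_ l) b by rewrite genB.
    move=> /(_ [set b | S (inB b)]); apply; split.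
      split=> [|x y Sx Sy]; first by rewrite /= (morph1 (amalgam_inrM K xi)).
      by rewrite /= amalgam_inrM (morphV (amalgam_inrM K xi)); exact: Sd.
    move=> x [Xx|[l _ Bx]]; apply: SXH; first by left; right; exists x.
    by right; exists (inr l) => //; exists x.
  have SA a : S (inA a).
    have : gen_subgroup (X1 `|` \bigcup_l add_subgroup A_ K l) a by rewrite genA.
    move=> /(_ [set a | S (inA a)]); apply; split.
      split=> [|x y Sx Sy]; first by rewrite /= (morph1 (amalgam_inlM K xi)).
      by rewrite /= amalgam_inlM (morphV (amalgam_inlM K xi)); exact: Sd.
    move=> x [Xx|[[mu|] _ Ax]] /=; first by apply: SXH; left; left; exists x.
      by apply: SXH; right; exists (inl mu) => //; exists x.
    by rewrite amalgam_inlE.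
  by apply: (@pres_group_ind _ _ S) => // -[a|b] x Sx; apply: SM => //; try apply: SV;
    [exact: SA|exact: SB|exact: SA|exact: SB].
- apply/seteqP; split=> [w w1|w]; last first.
    by move=> /area_le_normal_closure[n]; exact: area_le_rel_free_hom.
  apply/area_le_normal_closure.
  (* Modulo the relators, w is the image of a word in the letters of [A] and [B]. Once this holds
     for all w, a w trivial in the amalgam yields a trivial word, whose area was bounded above. *)
  pose P w := exists W n,
    area_le R n (w / letters_image (lift_A lift1) (lift_B lift2) W).
  have PM u v : P u -> P v -> P (u * v).
    move=> [U [m Um]] [V [n Vn]]; exists (U ++ V), (m + n)%N.
    by rewrite /letters_image big_cat; exact: area_le_divM.
  (* An element of [FA] may involve formal inverses; it is replaced by a relative word with the same
     value in [A], the difference having finite area over [R1]. *)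
  have PA u : P (lift_A lift1 u).
    have [U UE] := rel_word_surj subAK symA genA (rel_free_hom u).
    have [n un] : exists n, area_le R1 n (u / rel_word_free U).
      apply: (rel_presentation_area pA).
      by rewrite rel_free_homM (morphV (@rel_free_homM _ _ _ _)) UE mulgV.
    exists [seq inl l | l <- U], (1 * n)%N; rewrite /letters_image big_map.
    rewrite -(morph_prod (lift_AM lift1)) -(morphV (lift_AM lift1)) -(lift_AM lift1).
    exact: (area_le_morph (lift_AM lift1) R1R).
  have PB u : P (lift_B lift2 u).
    have [U UE] := rel_word_surj subB symB genB (rel_free_hom u).
    have [n un] : exists n, area_le R2 n (u / rel_word_free U).
      apply: (rel_presentation_area pB).
      by rewrite rel_free_homM (morphV (@rel_free_homM _ _ _ _)) UE mulgV.
    exists [seq inr l | l <- U], (1 * n)%N; rewrite /letters_image big_map.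
    rewrite -(morph_prod (lift_BM lift2)) -(morphV (lift_BM lift2)) -(lift_BM lift2).
    exact: (area_le_morph (lift_BM lift2) R2R).
  have [W [n wW]] : P w.
    (* The formal inverse of a basis letter is not the basis letter of the inverse, but it is again
       a lift, so [PA] or [PB] covers it. *)
    have PX (x : X) : P (basis_gen H x) /\ P (basis_gen H x)^-1.
      case: (set_mem (valP x)) => -[y Xy yx].
        have -> : basis_gen H x = lift_A lift1 (basis_gen _ (SigSub (mem_set Xy))).
          by rewrite lift_A_basis; congr basis_gen; apply: val_inj.
        by rewrite -(morphV (lift_AM lift1)).
      have -> : basis_gen H x = lift_B lift2 (basis_gen _ (SigSub (mem_set Xy))).
        by rewrite lift_B_basis; congr basis_gen; apply: val_inj.
      by rewrite -(morphV (lift_BM lift2)).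
    elim/(rel_free_ind (X := X) subG): w {w1} => [|x u Pu|x u Pu|i g Hg u Pu].
    - by exists [::], 0%N; rewrite /letters_image big_nil divg1; exact: area_le0.
    - by apply: PM => //; case: (PX x).
    - by apply: PM => //; case: (PX x).
    - apply: PM => //.
      have [W _ WE] := factor_gen_letters lift1 lift2 Hg.
      by exists W, 0%N; rewrite WE mulgV; exact: area_le0.
  have W1 : letters_val xi W = 1.
    by rewrite -(rel_free_hom_letters lift1K lift2K) -(area_le_rel_free_hom_eq Rker wW).
  have := area_leM wW (lifted_letters_image_area R1R R2R W1).
  by rewrite mulgVK; eexists; eassumption.
Qed.

(** For an arbitrary finite presentation, a word is first rewritten in the letters of [A] and [B] at
    linear cost, and the reduction of syllables is then applied to the result. *)
Lemma amalgam_rel_Dehn (X : set G) (R : set (rel_free H X)) :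
  finite_rel_presentation R ->
  exists2 delta, is_rel_Dehn R delta & asymp_le delta (gbar \o gbar).
Proof.
move=> [pR finX _].
have [pA _ finR1] := presA; have [pB _ finR2] := presB.
have [symG genG _] := pR.
have subG := is_subgroup_union_family.
have homM := @rel_free_homM _ _ H X.
have hom_surj g : exists u : rel_free H X, rel_free_hom u = g.
  by have [W WE] := rel_word_surj subG symG genG g; exists (rel_word_free W).
have [lift1 lift1K] := choice (fun x : X1 => hom_surj (inA (val x))).
have [lift2 lift2K] := choice (fun x : X2 => hom_surj (inB (val x))).
pose img := letters_image (lift_A lift1) (lift_B lift2).
have [a1 R1a] : exists a, forall r, R1 r -> area_le R a (lift_A lift1 r).
  apply: finite_set_bound => // [r m n|r Rr]; first exact: area_leW.
  apply: (rel_presentation_area pR).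
  rewrite (rel_free_hom_lift_A lift1K) (rel_presentation_rel1 pA Rr).
  exact: morph1 (amalgam_inlM K xi).
have [a2 R2a] : exists a, forall r, R2 r -> area_le R a (lift_B lift2 r).
  apply: finite_set_bound => // [r m n|r Rr]; first exact: area_leW.
  apply: (rel_presentation_area pR).
  rewrite (rel_free_hom_lift_B lift2K) (rel_presentation_rel1 pB Rr).
  exact: morph1 (amalgam_inrM K xi).
(* One constant bounds both the length of the word replacing a generator and the area of the
   replacement. *)
have [b Xb] : exists b, forall g, X g -> exists2 W, (size W <= b)%N &
    forall Xg : g \in X, area_le R b (basis_gen H (SigSub Xg) / img W).
  apply: finite_set_bound => // [g m n mn [W Wm Wg]|g Xg].
    by exists W => [|Xg]; [exact: leq_trans mn | exact: area_leW (Wg Xg)].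
  have [W WE] := letters_val_surj g.
  have [n nW] : exists n, area_le R n (basis_gen H (SigSub (mem_set Xg)) / img W).
    apply: (rel_presentation_area pR); rewrite homM (morphV homM).
    by rewrite (rel_free_hom_letters lift1K lift2K) WE rel_free_hom_basis_gen mulgV.
  exists (maxn n (size W)), W; first exact: leq_maxr.
  move=> Xg'; rewrite (bool_irrelevance Xg' (mem_set Xg)).
  by apply: area_leW nW; exact: leq_maxl.
(* The successor leaves room for a factor letter, which is replaced by up to one letter even when b
   = 0. *)
have words V : exists2 W, (size W <= b.+1 * size V)%N &
    area_le R (b.+1 * size V) (rel_word_free V / img W).
  elim: V => [|s V [W WV areaW]].
    by exists [::] => //; rewrite /rel_word_free /img /letters_image !big_nil divg1;
      exact: area_le0.
  have [Ws Wsb areaWs] : exists2 W, (size W <= b.+1)%N &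
      area_le R b.+1 (rel_letter_free s / img W).
    case: (rel_letter_freeP s) => [[x ->]|[l [h [Hh ->]]]].
      case: x => x Xx; have [W' W'b areaW'] := Xb x (set_mem Xx).
      by exists W'; [exact: leqW | apply: area_leW (areaW' _)].
    have [W' W'b ->] := factor_gen_letters lift1 lift2 Hh.
    by exists W'; [exact: leq_trans W'b _ | rewrite mulgV; exact: area_le0].
  exists (Ws ++ W); first by rewrite size_cat /= mulnS leq_add.
  rewrite /= mulnS -cat1s rel_word_free_cat /img /letters_image big_cat.
  by apply: area_le_divM => //; rewrite /rel_word_free big_seq1.
(* The term [b.+1 * n] pays for the rewriting; the other one bounds the area of a rewritten word of
   length at most [b.+1 * n], each lifted relator costing at most [maxn a1 a2]. *)
have dehn n V : (size V <= n)%N -> rel_free_hom (rel_word_free V) = 1 ->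
    area_le R (maxn a1 a2 * gbar (3 * b.+1 * n) + b.+1 * n) (rel_word_free V).
  move=> Vn V1; have [W WV areaW] := words V.
  have W1 : letters_val xi W = 1.
    rewrite -(rel_free_hom_letters lift1K lift2K) -V1; apply/esym.
    exact: (area_le_rel_free_hom_eq (rel_presentation_rel1 pR) areaW).
  have img_area : area_le R (maxn a1 a2 * gbar (3 * size W)) (img W).
    apply: lifted_letters_image_area => // r Rr.
      by apply: area_leW (R1a r Rr); exact: leq_maxl.
    by apply: area_leW (R2a r Rr); exact: leq_maxr.
  have := area_leM areaW img_area; rewrite mulgVK addnC; apply: area_leW.
  apply: leq_add; last by rewrite leq_mul2l Vn orbT.
  rewrite leq_mul2l leq_superadditive_closure ?orbT // -mulnA leq_mul2l.
  by apply: leq_trans WV _; rewrite leq_mul2l Vn.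
have [delta dehn_delta delta_le] := is_rel_Dehn_exists dehn.
by exists delta => //; apply: asymp_le_comp_superadditive_closure delta_le.
Qed.

End Amalgam.

Theorem theorem1p3 (A B : groupType) (M N : Type)
  (A_ : M -> set A) (K : set A) (B_ : N -> set B)
  (subA : forall mu, is_subgroup (A_ mu)) (subK : is_subgroup K)
  (subB : forall nu, is_subgroup (B_ nu))
  (X1 : set A) (R1 : set (rel_free (add_subgroup A_ K) X1))
  (X2 : set B) (R2 : set (rel_free B_ X2))
  (presA : finite_rel_presentation R1)
  (presB : finite_rel_presentation R2)
  (gamma1 gamma2 : nat -> nat)
  (dehnA : is_rel_Dehn R1 gamma1) (dehnB : is_rel_Dehn R2 gamma2)
  (fgK : finitely_generated K)
  (eta : N) (xi : A -> B)
  (xiM : forall x y, K x -> K y -> xi (x * y) = xi x * xi y)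
  (xi_inj : forall x y, K x -> K y -> xi x = xi y -> x = y)
  (xi_eta : forall x, K x -> B_ eta (xi x)) :
  let gamma n := maxn (gamma1 n) (gamma2 n) in
  let H := union_family (fun mu => amalgam_inl K xi @` A_ mu)
                        (fun nu => amalgam_inr K xi @` B_ nu) in
  finitely_presented_rel H /\
  forall (X : set (amalgam K xi)) (R : set (rel_free H X)),
    finite_rel_presentation R ->
    exists2 delta, is_rel_Dehn R delta &
      asymp_le delta
        (superadditive_closure gamma \o superadditive_closure gamma).
Proof.
move=> gamma H; split.
  exact: (amalgam_finitely_presented_rel subA subK subB presA presB
    dehnA.1 dehnB.1 xiM xi_inj xi_eta).
move=> X R presR; exact: (amalgam_rel_Dehn subA subK subB presA presB
  dehnA.1 dehnB.1 xiM xi_inj xi_eta presR).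
Qed.
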